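(* Assume (F1), (F2), (H1), (H2). Then the travelling wave problem with speed $c=c^*$ has a solution $\phi$ with $0<\phi(\xi)<K$ and $\phi'(\xi)>0$ for all $\xi\in\mathbb{R}$.
   Context: Fix constants $d>0$, $\tau\geq0$, $K>0$, $f:[0,K]^2\to\mathbb{R}$ and $h:\mathbb{R}\to\mathbb{R}$ (partial derivatives of $f$ assumed to exist). (F1) $f\in C([0,K]^2,\mathbb{R})$, $f(0,0)=f(K,K)=0$, $f(u,u)>0$ for $u\in(0,K)$, $\partial_2f(u,v)\geq0$ on $[0,K]^2$. (F2) There exist $M>0$, $\sigma\in(0,1]$ with $0\leq \partial_1f(0,0)u+\partial_2f(0,0)v-f(u,v)\leq M(u+v)^{1+\sigma}$ on $[0,K]^2$, and $\partial_1f(K,K)+\partial_2f(K,K)<0$. (H1) $h\ge0$, even, integrable, $\int_{\mathbb{R}}h=1$. (H2) There is $\lambda_0\in(0,\infty]$ with $\int_0^\infty h(x)e^{\lambda x}dx<\infty$ for all $\lambda<\lambda_0$. Let $G(\lambda)=\int_{\mathbb{R}}h(y)e^{-\lambda y}dy$, $\lambda^+=\lambda_0$ if $\partial_2f(0,0)>0$ and $\lambda^+=+\infty$ otherwise, and $\Delta(c,\lambda)=c\lambda-d[e^{\lambda}+e^{-\lambda}-2]-\partial_1f(0,0)-\partial_2f(0,0)e^{-\lambda c\tau}G(\lambda)$. Let $c^*>0$ be the unique number for which there is $\lambda^*\in(0,\lambda^+)$ with $\Delta(c^*,\lambda^* )=0=\partial_\lambda\Delta(c^*,\lambda^* )$.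 Notation: $\Delta_1\phi(\xi)=\phi(\xi+1)-2\phi(\xi)+\phi(\xi-1)$, $(h*\phi)(\xi)=\int h(y)\phi(\xi-y)dy$. The travelling wave problem with speed $c>0$: find differentiable $\phi:\mathbb{R}\to\mathbb{R}$ with $-c\phi'(\xi)+d\Delta_1\phi(\xi)+f(\phi(\xi),(h*\phi)(\xi-c\tau))=0$ for all $\xi$, $\phi(-\infty)=0$, $\phi(+\infty)=K$, $0\le\phi\le K$. *)

(* Defs.v *)
From HB Require Import structures.
From mathcomp Require Import all_boot all_order all_algebra.
From mathcomp Require Import all_classical all_reals all_analysis.
Set Implicit Arguments. Unset Strict Implicit. Unset Printing Implicit Defensive.
Import Order.TTheory GRing.Theory Num.Theory.
Import numFieldNormedType.Exports.
Local Open Scope classical_set_scope.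
Local Open Scope ring_scope.

Section Defs.
Variable R : realType.

Definition sq (K u v : R) : Prop := (0 <= u <= K) /\ (0 <= v <= K).

(* partial derivatives of f : [0,K]^2 -> R, taken within the square
   (one-sided at boundary points) *)
Definition has_pd1 (K : R) (f : R -> R -> R) (u v l : R) : Prop :=
  (fun t => (f (u + t) v - f u v) / t) @ within [set t | 0 <= u + t <= K] 0^' --> l.
Definition has_pd2 (K : R) (f : R -> R -> R) (u v l : R) : Prop :=
  (fun t => (f u (v + t) - f u v) / t) @ within [set t | 0 <= v + t <= K] 0^' --> l.

Definition convol (h phi : R -> R) (xi : R) : R :=
  Rintegral (@lebesgue_measure R) setT (fun y => h y * phi (xi - y)).

Definition Gfun (h : R -> R) (lam : R) : R :=
  Rintegral (@lebesgue_measure R) setT (fun y => h y * expR (- lam * y)).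

(* Delta(c, lambda), with d1 = d_1 f(0,0), d2 = d_2 f(0,0) *)
Definition Delta (d tau d1 d2 : R) (h : R -> R) (c lam : R) : R :=
  c * lam - d * (expR lam + expR (- lam) - 2) - d1
  - d2 * expR (- lam * c * tau) * Gfun h lam.

Definition Delta1 (phi : R -> R) (xi : R) : R :=
  phi (xi + 1) - 2 * phi xi + phi (xi - 1).

Definition lamplus (d2 : R) (lam0 : \bar R) : \bar R :=
  if 0 < d2 then lam0 else +oo%E.

Definition crit (d tau d1 d2 : R) (h : R -> R) (lam0 : \bar R) (c : R) : Prop :=
  exists lam : R, 0 < lam /\ (lam%:E < lamplus d2 lam0)%E /\
    Delta d tau d1 d2 h c lam = 0 /\
    is_derive lam 1 (Delta d tau d1 d2 h c) 0.

End Defs.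

(* Main.v *)
Require Import Defs.
From HB Require Import structures.
From mathcomp Require Import all_boot all_order all_algebra.
From mathcomp Require Import all_classical all_reals all_analysis.
From mathcomp Require Import measurable_realfun lebesgue_integral_under ring lra.
Set Implicit Arguments. Unset Strict Implicit. Unset Printing Implicit Defensive.
Import Order.TTheory GRing.Theory Num.Theory.
Import numFieldNormedType.Exports.
Local Open Scope classical_set_scope.
Local Open Scope ring_scope.

(* The critical speed enters only through a point lams with
   Delta (cs, lams) = 0.  Discretising the derivative with step dl > 0 turns the
   dispersion relation into one that is positive at lams, so it has a last zero
   l1 below lams, and min (K, K e^(l1 x)) and
   K (e^(l1 x) - q e^(l2 x)), with l2 slightly above l1, are ordered super- and
   subsolutions of a monotone fixed-point equation.  Its least supersolution in
   between is a monotone wave of the discretised problem from 0 to K.  Pinned at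
   level K / 2, these waves are equi-Lipschitz up to dl, so along an ultrafilter
   they converge as dl -> 0 to a monotone solution; its end states are zeros of
   f (u, u) on either side of K / 2, hence 0 and K.  If phi' vanished somewhere,
   a backward Gronwall estimate would make phi constant to the left, hence 0. *)

(** By convexity of its exponential terms, [Delta (cs, .)] is concave and touches zero from below at
    its double root, so no exponent has the strict sign that the term [q e^(l2 x)] of a subsolution
    needs. A forward difference has symbol [(e^(l dl) - 1) / dl > l], which creates this room
    without changing the speed. It also makes the equation explicit: [phi (x + dl)] is a monotone
    expression in translates and averages of [phi], so the order argument needs neither continuity
    of profiles nor compactness. The obstacle is the weak regularity of [f]: with mere partial
    derivatives, adding a multiple of [u] need not make [f (u, v)] nondecreasing in [u]. A monotone
    envelope takes its place, at the price of a residual [e] that is sent to zero with [dl]. Only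
    Lipschitz bounds centred at a fixed point survive; they are used at [K], to make the constant
    [K] a supersolution, and at a putative critical point of the wave. *)

Definition profile {R : realType} (K : R) (phi : R -> R) : Prop :=
  {homo phi : x y / x <= y} /\ forall x, 0 <= phi x <= K.

Section integrable_EFin.
Context d (T : measurableType d) (R : realType).
Variables (mu : {measure set T -> \bar R}) (D : set T).
Hypothesis mD : measurable D.
Implicit Types f g : T -> R.

Lemma integrable_EFinD f g :
  mu.-integrable D (EFin \o f) -> mu.-integrable D (EFin \o g) ->
  mu.-integrable D (EFin \o (fun x => f x + g x)).
Proof. exact: integrableD. Qed.

Lemma integrable_EFinZl r f : mu.-integrable D (EFin \o f) ->
  mu.-integrable D (EFin \o (fun x => r * f x)).
Proof. exact: integrableZl. Qed.

End integrable_EFin.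

(** * Convolution of monotone profiles with the kernel *)

Section kernel.
Context {R : realType}.
Variable h : R -> R.
Notation mu := (@lebesgue_measure R).
Hypothesis h_ge0 : forall x, 0 <= h x.
Hypothesis h_int : mu.-integrable setT (EFin \o h).
Hypothesis h_mass : (\int[mu]_x (h x)%:E = 1)%E.
Implicit Types phi : R -> R.

Lemma measurable_kernel : measurable_fun setT h.
Proof. by apply/measurable_EFinP; exact: measurable_int h_int. Qed.

Lemma Rintegral_kernel : Rintegral mu setT h = 1.
Proof. by rewrite /Rintegral h_mass. Qed.

Lemma integrable_kernelM (B : R) phi : measurable_fun setT phi ->
  (forall x, `|phi x| <= B) ->
  mu.-integrable setT (EFin \o (fun y => h y * phi y)).
Proof.
move=> mphi phiB.
have B0 : 0 <= B by rewrite (le_trans _ (phiB 0)).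
apply: (@le_integrable _ _ _ mu setT measurableT _
  (fun y => B%:E * (EFin \o h) y)%E); last exact: integrableZl.
  by apply/measurable_EFinP; apply: measurable_funM => //; exact: measurable_kernel.
move=> y _ /=; rewrite lee_fin !normrM (ger0_norm B0) ger0_norm// mulrC.
by rewrite ler_wpM2r.
Qed.

(** Profiles may jump, but monotonicity alone makes them Borel, so that [convol] is a genuine
    integral and not a default value. *)
Lemma measurable_profile_shift (K : R) phi (x : R) : profile K phi ->
  measurable_fun setT (fun y : R => phi (x - y)).
Proof.
move=> [ndphi _].
apply: (@measurableT_comp _ _ _ _ _ _ phi setT (fun y : R => x - y)).
  by apply: nondecreasing_measurable => // ? ?; exact: ndphi.
exact: measurable_funB.
Qed.

Lemma integrable_convol (K : R) phi x : profile K phi ->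
  mu.-integrable setT (EFin \o (fun y => h y * phi (x - y))).
Proof.
move=> pphi; apply: (@integrable_kernelM K).
  exact: measurable_profile_shift pphi.
by move=> y; case: pphi => _ /(_ (x - y)) /andP[? ?]; rewrite ger0_norm.
Qed.

(** With two functions and two base points at once, this gives bounds by constants, monotonicity in
    [x] and comparison of translates. *)
Lemma convol_le (K : R) phi1 phi2 x1 x2 : profile K phi1 -> profile K phi2 ->
  (forall y, phi1 (x1 - y) <= phi2 (x2 - y)) ->
  convol h phi1 x1 <= convol h phi2 x2.
Proof.
move=> p1 p2 le12; apply: le_Rintegral => //.
- exact: integrable_convol p1.
- exact: integrable_convol p2.
- by move=> y _; rewrite ler_wpM2l.
Qed.

Lemma convol_cst a x : convol h (fun=> a) x = a.
Proof.
rewrite /convol; under eq_Rintegral do rewrite mulrC.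
by rewrite RintegralZl// Rintegral_kernel mulr1.
Qed.

Lemma profile_cst (K a : R) : 0 <= a <= K -> profile K (fun=> a).
Proof. by move=> aK; split. Qed.

Lemma convol_itv (K : R) phi x : profile K phi -> 0 <= convol h phi x <= K.
Proof.
move=> pphi; have bphi := pphi.2.
have K0 : 0 <= K by case/andP: (bphi 0) => /le_trans; apply.
apply/andP; split.
  rewrite -[leLHS](convol_cst 0 x); apply: (@convol_le K) => //.
    by apply: profile_cst; rewrite lexx.
  by move=> y; case/andP: (bphi (x - y)).
rewrite -[leRHS](convol_cst K x); apply: (@convol_le K) => //.
  by apply: profile_cst; rewrite lexx K0.
by move=> y; case/andP: (bphi (x - y)).
Qed.

Lemma convol_homo (K : R) phi : profile K phi ->
  {homo convol h phi : x y / x <= y}.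
Proof.
move=> pphi x y xy; apply: (@convol_le K) => // z.
by apply: pphi.1; rewrite lerB.
Qed.

Let far (A : R) : set R := [set y | A < `|y|].

Lemma measurable_far A : measurable (far A).
Proof.
have -> : far A = (Num.norm : R -> R) @^-1` `]A, +oo[.
  by apply/seteqP; split => y /=; rewrite in_itv/= andbT.
rewrite -[X in measurable X]setTI.
by apply: (@normr_measurable R setT); rewrite //; exact: measurable_itv.
Qed.

Lemma integrable_far A :
  mu.-integrable setT (EFin \o (fun y => h y * \1_(far A) y)).
Proof.
apply: (@integrable_kernelM 1) => [|y].
  by apply: measurable_indic; exact: measurable_far.
by rewrite indicE; case: (_ \in _); rewrite /= ?normr1 ?normr0.
Qed.

Lemma kernel_far (e : R) : 0 < e ->
  exists A, Rintegral mu setT (fun y => h y * \1_(far A) y) <= e.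
Proof.
move=> e0.
have : (\int[mu]_x (h x * \1_(far n%:R) x)%:E @[n --> \oo] --> \int[mu]_x (cst 0 x))%E.
  apply: (@dominated_cvg _ _ _ mu setT measurableT _ _ (EFin \o h)) => //.
  - by move=> n; have /(measurable_int mu) := integrable_far n%:R.
  - move=> y _; apply: cvg_near_cst.
    near=> n; rewrite indicE memNset ?mulr0// /far /= => /ltW.
    apply/negP; rewrite -ltNge; near: n; exact: nbhs_infty_gtr.
  - move=> n y _ /=; rewrite lee_fin indicE normrM (ger0_norm (h_ge0 _)).
    by rewrite ler_piMr//; case: (_ \in _); rewrite /= ?normr1 ?normr0.
rewrite integral0 => /fine_cvgP[_] /cvgrPdist_le /(_ _ e0) [N _ /(_ N (leqnn N))].
rewrite /= sub0r normrN => le_e; exists N%:R.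
exact: le_trans (ler_norm _) le_e.
Unshelve. all: by end_near. Qed.

(** Outside a window carrying all but [e / (K + 1)] of the mass, two profiles differ by at most [K].
    The window depends on neither profile, so locally uniform convergence passes through the
    convolution. Dividing by [K + 1] also covers [K = 0]. *)
Lemma convol_le_far (K e : R) : 0 <= K -> 0 < e -> exists A : R,
  forall phi1 phi2 x1 x2, profile K phi1 -> profile K phi2 ->
  (forall y, `|y| <= A -> phi1 (x1 - y) <= phi2 (x2 - y) + e) ->
  convol h phi1 x1 <= convol h phi2 x2 + 2 * e.
Proof.
move=> K0 e0; have K1 : 0 < K + 1 by rewrite ltr_wpDl.
have [A hA] := kernel_far (divr_gt0 e0 K1).
exists A => phi1 phi2 x1 x2 p1 p2 le12.
have i2 := integrable_convol x2 p2.
have ie : mu.-integrable setT (EFin \o (fun y => e * h y)).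
  exact: integrable_EFinZl.
have iK : mu.-integrable setT (EFin \o (fun y => (K + 1) * (h y * \1_(far A) y))).
  by apply: integrable_EFinZl => //; exact: integrable_far.
have i2e := integrable_EFinD measurableT i2 ie.
apply: (@le_trans _ _ (Rintegral mu setT (fun y =>
   (h y * phi2 (x2 - y) + e * h y) + (K + 1) * (h y * \1_(far A) y)))).
  apply: le_Rintegral => //; first exact: integrable_convol p1.
    exact: integrable_EFinD.
  move=> y _; rewrite indicE /far.
  have [yA|yA] := lerP `|y| A.
    rewrite memNset /=; last by apply/negP; rewrite -leNgt.
    by rewrite !mulr0 addr0 [e * _]mulrC -mulrDr ler_wpM2l// le12.
  rewrite mem_set//= mulr1.
  have /andP[_ b1] := p1.2 (x1 - y); have /andP[b2 _] := p2.2 (x2 - y).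
  have := h_ge0 y; nra.
rewrite RintegralD// RintegralD// RintegralZl// RintegralZl//; last exact: integrable_far.
rewrite Rintegral_kernel mulr1 /convol -addrA lerD2l mulr_natl mulr2n lerD2l.
by move: hA; rewrite ler_pdivlMr// mulrC.
Qed.

End kernel.

(** * Exponential moments of the kernel *)

Section exponential_moments.
Context {R : realType}.
Variables (h : R -> R) (lam0 : \bar R).
Notation mu := (@lebesgue_measure R).
Hypothesis h_ge0 : forall x, 0 <= h x.
Hypothesis h_even : forall x, h (- x) = h x.
Hypothesis h_int : mu.-integrable setT (EFin \o h).
Hypothesis h_exp : forall lam : R, (lam%:E < lam0)%E ->
  (\int[mu]_(x in `[0%R, +oo[) (h x * expR (lam * x))%:E < +oo)%E.

Let measurable_kernelM (lam : R) :
  measurable_fun setT (fun y => h y * expR (lam * y)).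
Proof.
apply: measurable_funM; first exact: (measurable_kernel h_int).
by apply: measurableT_comp => //; exact: measurable_funM.
Qed.

(** (H2) controls one half-line only: it is applied at [- lam] on the positive side, and at [lam] on
    the negative side after the reflection [y -> - y], which evenness of [h] permits. *)
Lemma integrable_exp_moment (lam : R) : (`|lam|%:E < lam0)%E ->
  mu.-integrable setT (EFin \o (fun y => h y * expR (- lam * y))).
Proof.
move=> ltlam; apply/integrableP; split.
  by apply/measurable_EFinP; exact: measurable_kernelM.
under eq_integral => y _ do
  rewrite /= ger0_norm ?mulr_ge0 ?expR_ge0//.
have mE (l : R) (A : set R) : measurable_fun A (fun y => (h y * expR (l * y))%:E).
  by apply/measurable_funTS/measurable_EFinP; exact: measurable_kernelM.
have ge0E (l : R) y : (0 <= (h y * expR (l * y))%:E)%E.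
  by rewrite lee_fin mulr_ge0// expR_ge0.
have lt_lam : (lam%:E < lam0)%E by rewrite (le_lt_trans _ ltlam)// lee_fin ler_norm.
have ltN_lam : ((- lam)%:E < lam0)%E.
  by rewrite (le_lt_trans _ ltlam)// lee_fin -normrN ler_norm.
have -> : [set: measurableTypeR R] = `]-oo, 0%R[ `|` `[0%R, +oo[.
  by apply/esym; rewrite -setCitvr setvU.
rewrite ge0_integral_setU//=; [|exact: mE|]; last first.
  apply/disj_setPS => y [] /=; rewrite !in_itv/= andbT => y0 /le_lt_trans /(_ y0).
  by rewrite ltxx.
rewrite lte_add_pinfty//; last exact: h_exp.
apply: (@le_lt_trans _ _ (\int[mu]_(y in `]-oo, 0%R]) (h y * expR (- lam * y))%:E)%E).
  apply: ge0_subset_integral => //=; first exact: mE.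
  by move=> y /=; rewrite !in_itv/=; exact: ltW.
have := ge0_integration_by_substitution0 (mE lam setT) (ge0E lam).
under [X in _ = X -> _]eq_integral do rewrite h_even mulrN -mulNr.
move=> E.
exact: (eq_ind _ (fun z => z < +oo)%E (h_exp lt_lam) _ E).
Qed.

Lemma Gfun_ge0 lam : 0 <= Gfun h lam.
Proof. by apply: Rintegral_ge0 => y _; rewrite mulr_ge0// expR_ge0. Qed.

Lemma Gfun_continuous (lam : R) : (`|lam|%:E < lam0)%E -> {for lam, continuous (Gfun h)}.
Proof.
move=> ltlam.
have [b lamb blam0] : exists2 b : R, `|lam| < b & (b%:E < lam0)%E.
  case: lam0 ltlam => [r| |]; rewrite ?lte_fin => ltlam.
  - by exists ((`|lam| + r) / 2); rewrite ?lte_fin ?midf_lt.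
  - by exists (`|lam| + 1); rewrite ?ltey// ltrDl.
  - by rewrite ltNge leNye in ltlam.
have b0 : 0 < b := le_lt_trans (normr_ge0 _) lamb.
(* For [|l| <= b] the sum [e^(b y) + e^(- b y)] dominates [e^(- l y)] on both half-lines. *)
have int_b : mu.-integrable setT (EFin \o
    (fun y => h y * expR (- b * y) + h y * expR (- - b * y))).
  apply: integrable_EFinD => //; apply: integrable_exp_moment.
    by rewrite gtr0_norm.
  by rewrite normrN gtr0_norm.
apply: (@continuity_under_integral R _ _ mu (fun l y => h y * expR (- l * y))
   setT measurableT (- b) b _ _ _ int_b).
- move=> l /=; rewrite in_itv/= -ltr_norml => lb.
  by apply: integrable_exp_moment; rewrite (lt_trans _ blam0)// lte_fin.
- apply: aeW => y _ l _.
  apply: cvgM; first exact: cvg_cst.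
  apply: continuous_comp; last exact: continuous_expR.
  by apply: cvgM; [apply: cvgN; exact: cvg_id|exact: cvg_cst].
- move=> l /=; rewrite in_itv/= -ltr_norml => /ltW lb; apply: aeW => y _.
  rewrite normrM (ger0_norm (h_ge0 y)) ger0_norm ?expR_ge0// -mulrDr.
  rewrite ler_wpM2l// opprK.
  have /ler_normlP[ly1 ly2] : `|- l * y| <= b * `|y|.
    by rewrite normrM normrN ler_wpM2r.
  have [y0|y0] := lerP 0 y.
    rewrite ger0_norm// in ly2; apply: (@le_trans _ _ (expR (b * y))).
      by rewrite ler_expR.
    by rewrite lerDr expR_ge0.
  rewrite ltr0_norm// mulrN -mulNr in ly2.
  apply: (@le_trans _ _ (expR (- b * y))); first by rewrite ler_expR.
  by rewrite lerDl expR_ge0.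
- by rewrite inE/= in_itv/= -ltr_norml.
Qed.

(** Exponentials are eigenfunctions of the convolution, with eigenvalue [Gfun h lam]. *)
Lemma convol_le_expR (K lam : R) phi x : (`|lam|%:E < lam0)%E ->
  profile K phi -> (forall y, phi y <= K * expR (lam * y)) ->
  convol h phi x <= K * expR (lam * x) * Gfun h lam.
Proof.
move=> ltlam pphi lephi.
have int_lam := integrable_exp_moment ltlam.
rewrite /Gfun -RintegralZl//; apply: le_Rintegral => //.
- exact: integrable_convol pphi.
- exact: integrable_EFinZl.
move=> y _; rewrite mulrCA ler_wpM2l// (le_trans (lephi _))//.
by rewrite -mulrA -expRD mulrBr mulNr.
Qed.

Lemma convol_ge_expR (K q lam1 lam2 : R) phi x :
  (`|lam1|%:E < lam0)%E -> (`|lam2|%:E < lam0)%E -> profile K phi ->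
  (forall y, K * (expR (lam1 * y) - q * expR (lam2 * y)) <= phi y) ->
  K * (expR (lam1 * x) * Gfun h lam1 - q * (expR (lam2 * x) * Gfun h lam2))
    <= convol h phi x.
Proof.
move=> lt1 lt2 pphi lephi.
have int1 := integrable_exp_moment lt1; have int2 := integrable_exp_moment lt2.
have i1 := integrable_EFinZl measurableT (K * expR (lam1 * x)) int1.
have i2 := integrable_EFinZl measurableT (- (K * q * expR (lam2 * x))) int2.
have -> : K * (expR (lam1 * x) * Gfun h lam1 - q * (expR (lam2 * x) * Gfun h lam2))
    = (K * expR (lam1 * x)) * Gfun h lam1
      + (- (K * q * expR (lam2 * x))) * Gfun h lam2 by ring.
rewrite /Gfun -(RintegralZl _ _ int1)// -(RintegralZl _ _ int2)//.
rewrite -RintegralD//; apply: le_Rintegral => //.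
- exact: integrable_EFinD.
- exact: integrable_convol pphi.
move=> y _; rewrite [X in X + _]mulrCA [X in _ + X]mulrCA -mulrDr ler_wpM2l//.
apply: le_trans (lephi _); rewrite !mulrBr !expRD !mulNr.
by rewrite le_eqVlt; apply/orP; left; apply/eqP; ring.
Qed.

End exponential_moments.

(** * Uniform continuity, pointwise Lipschitz bounds and monotonicity of [f] *)

Section nonlinearity.
Context {R : realType}.
Variables (K : R) (f d1f d2f : R -> R -> R).
Hypothesis f_pd1 : forall u v, sq K u v -> has_pd1 K f u v (d1f u v).
Hypothesis f_pd2 : forall u v, sq K u v -> has_pd2 K f u v (d2f u v).
Hypothesis f_cont :
  {within [set p : R * R | sq K p.1 p.2], continuous (fun p => f p.1 p.2)}.
Hypothesis d2f_ge0 : forall u v, sq K u v -> 0 <= d2f u v.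

Lemma compact_sq : compact [set p : R * R | sq K p.1 p.2].
Proof.
have -> : [set p : R * R | sq K p.1 p.2] = `[0, K] `*` `[0, K].
  by apply/seteqP; split => -[u v] /=; rewrite /sq !in_itv.
by apply: compact_setX; exact: segment_compact.
Qed.

Lemma f_bounded : exists B : R, 0 < B /\ forall u v, sq K u v -> `|f u v| <= B.
Proof.
have /compact_bounded [M [_ HM]] := continuous_compact f_cont compact_sq.
exists (`|M| + 1); split=> [|u v uv].
  by rewrite ltr_wpDl.
by apply: HM; [rewrite ltr_pwDr// ler_norm|exists (u, v)].
Qed.

Lemma f_unif (e : R) : 0 < e -> exists r, 0 < r /\
  forall u v u' v', sq K u v -> sq K u' v' -> `|u - u'| <= r -> `|v - v'| <= r ->
  `|f u v - f u' v'| <= e.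
Proof.
move=> e0; have e20 : 0 < e / 2 by rewrite divr_gt0.
pose A := [set p : R * R | sq K p.1 p.2].
have /compact_near_coveringP cov := compact_sq.
have : \forall r \near (0 : R)^'+, forall p, A p -> A p ->
    forall u' v', sq K u' v' -> `|p.1 - u'| <= r -> `|p.2 - v'| <= r ->
    `|f p.1 p.2 - f u' v'| <= e.
  apply: cov => -[u v] Auv.
  have /subspace_continuousP /(_ (u, v) Auv) /cvgrPdist_le /(_ _ e20) := f_cont.
  rewrite near_withinE => /nbhs_ballP[s /= s0 Hs].
  have s20 : 0 < s / 2 by rewrite divr_gt0.
  (* Half of the radius is kept for the displacement, so that both points being compared stay in the
     ball of radius [s]. *)
  exists (ball (u, v) (s / 2), [set r | 0 < r < s / 2]) => /=.
    split; first exact: nbhsx_ballx.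
    by near=> r; apply/andP; split; near: r; [exact: nbhs_right_gt|exact: nbhs_right_lt].
  move=> [[a b] r] /= [[/= ua vb] /andP[r0 rs]] Aab u' v' uv' au' bv'.
  have close (x y z : R) : ball x (s / 2) y -> `|y - z| <= r -> ball x s z.
    rewrite /ball/= => xy yz; rewrite [s]splitr.
    by rewrite (le_lt_trans (ler_distD y _ _))// ltr_leD// (le_trans yz)// ltW.
  have h1 := Hs (u', v') (conj (close _ _ _ ua au') (close _ _ _ vb bv')) uv'.
  have h2 := Hs (a, b) (conj (close _ _ a ua ltac:(by rewrite subrr normr0 ltW))
    (close _ _ b vb ltac:(by rewrite subrr normr0 ltW))) Aab.
  rewrite (le_trans (ler_distD (f u v) _ _))// [e]splitr lerD//.
  by rewrite distrC.
move=> [r /= r0 Hr]; exists (r / 2); have r20 : 0 < r / 2 by rewrite divr_gt0.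
split=> // u v u' v' uv uv' uu' vv'.
apply: (Hr (r / 2) _ _ (u, v)) => //=.
by rewrite /ball/= sub0r normrN gtr0_norm// ltr_pdivrMr// ltr_pMr// ltr1n.
Unshelve. all: by end_near. Qed.

(** Near [a] the difference quotient is within 1 of the derivative; at distance at least [s] from
    [a], boundedness of [f] gives the slope [2 * B / s]. The constant depends on [a] and [v]. *)
Lemma f_pd1_lip a v : sq K a v -> exists C, 0 < C /\
  forall w, 0 <= w <= K -> `|f w v - f a v| <= C * `|w - a|.
Proof.
move=> av; have [B [B0 HB]] := f_bounded.
have /cvgrPdist_le /(_ _ ltr01) := f_pd1 av.
rewrite near_withinE => /nbhs_ballP[s /= s0 Hs].
pose C1 := `|d1f a v| + 1; pose C2 := 2 * B / s.
have C10 : 0 < C1 by rewrite ltr_wpDl.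
have C20 : 0 < C2 by rewrite divr_gt0// mulr_gt0.
exists (C1 + C2); split; first exact: addr_gt0.
move=> w wK; have [->|wa] := eqVneq w a; first by rewrite !subrr normr0 mulr0.
have wa0 : 0 < `|w - a| by rewrite normr_gt0 subr_eq0.
have [ws|sw] := ltP `|w - a| s.
  have := Hs (w - a); rewrite /ball/= sub0r normrN subr_eq0 [a + _]addrC subrK.
  move=> /(_ ws wa wK) h.
  have h1 : `|(f w v - f a v) / (w - a)| <= C1.
    rewrite -[X in `|X|](subrK (d1f a v)) (le_trans (ler_normD _ _))//.
    by rewrite addrC lerD2l distrC.
  rewrite normrM normfV ler_pdivrMr// in h1.
  by rewrite (le_trans h1)// ler_wpM2r// lerDl ltW.
have wv : sq K w v by split => //; case: av.
have h2 : `|f w v - f a v| <= 2 * B.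
  by rewrite (le_trans (ler_normB _ _))// mulr_natl mulr2n lerD ?HB.
rewrite (le_trans h2)// (@le_trans _ _ (C2 * `|w - a|))//.
  by rewrite /C2 mulrAC ler_pdivlMr// ler_pM2l// mulr_gt0.
by rewrite ler_wpM2r// lerDr ltW.
Qed.

Lemma f_homo u v1 v2 : 0 <= u <= K -> 0 <= v1 -> v1 <= v2 -> v2 <= K ->
  f u v1 <= f u v2.
Proof.
move=> uK v10 v12 v2K.
have uv v : v \in `[0, K] -> sq K u v by rewrite in_itv.
have interior v : v \in `]0, K[ -> is_derive v 1 (f u) (d2f u v).
  move=> vI; have := vI; rewrite in_itv/= => /andP[v0 vK].
  have /uv suv : v \in `[0, K] by rewrite in_itv/= !ltW.
  have cv : (fun t => (f u (v + t) - f u v) / t) @ 0^' --> d2f u v.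
    apply: cvg_trans (f_pd2 suv) => P /= [r /= r0 HP].
    (* Below [min (v, K - v)] the increment cannot leave the square, so the restricted limit is an
       ordinary derivative. *)
    rewrite /nbhs/= /within/=; exists (Num.min r (Num.min v (K - v))) => /=.
      by rewrite !lt_min r0 v0 subr_gt0.
    move=> t; rewrite /ball/= sub0r normrN !lt_min => /and3P[tr tv tK] t0.
    apply: HP => //; first by rewrite /ball/= sub0r normrN.
    by move: tv tK; rewrite !ltr_norml; lra.
  have cv' : (fun t => t^-1 *: ((f u \o shift v) (t *: 1) - f u v)) @ 0^' --> d2f u v.
    apply: cvg_trans cv; apply: near_eq_cvg; near=> t.
    by rewrite /= /shift/= scaler1 [t + v]addrC mulrC.
  apply: DeriveDef; first by apply/cvg_ex; exists (d2f u v).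
  by rewrite /derive; apply/cvg_lim.
apply: (@ger0_derive1_le_cc R (f u) 0 K) => //; rewrite ?in_itv/=; last 2 first.
- by rewrite v10 (le_trans v12).
- by rewrite v2K (le_trans v10).
- by move=> v /interior[].
- move=> v vI; have := interior v vI; rewrite derive1E => /@derive_val ->.
  by apply/d2f_ge0/uv; apply: subset_itv_oo_cc vI.
- apply/subspace_continuousP => v /= vI.
  apply/cvgrPdist_le => e e0.
  have [r [r0 Hr]] := f_unif e0.
  rewrite /prop_near1 /nbhs/= /within/=; exists r => //= v' vv' v'I.
  by apply: Hr; rewrite ?subrr ?normr0 ?ltW//; apply: uv.
Unshelve. all: by end_near. Qed.

End nonlinearity.

(** * Positivity of the derivative of a monotone wave *)

Section strict_monotonicity.
Context {R : realType}.

Lemma homo_derive_ge0 (phi : R -> R) (x l : R) : {homo phi : x y / x <= y} ->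
  is_derive x (1 : R) phi l -> 0 <= l.
Proof.
move=> ndphi [/cvg_ex[m Hm] <-]; rewrite /derive (cvg_lim _ Hm)//.
apply: (closed_cvg _ (@closed_ge R 0) _ _ Hm).
near=> t; rewrite /= /shift/= scaler1.
have [t0|t0|->] := ltgtP t 0; last by rewrite add0r subrr scaler0.
- rewrite -[_ *: _]mulrNN -invrN mulr_ge0 ?invr_ge0 ?oppr_ge0//; first exact: ltW.
  by rewrite subr_le0 ndphi// gerDr ltW.
- rewrite -[_ *: _]/(_ * _) mulr_ge0 ?invr_ge0//; first exact: ltW.
  by rewrite subr_ge0 ndphi// lerDr ltW.
Unshelve. all: by end_near. Qed.

Variables (c d K : R) (f : R -> R -> R) (phi psi : R -> R).
Hypotheses (c0 : 0 < c) (d0 : 0 < d) (K0 : 0 < K).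
Hypothesis f_lip : forall a v, sq K a v -> exists C, 0 < C /\
  forall w, 0 <= w <= K -> `|f w v - f a v| <= C * `|w - a|.
Hypothesis f_homo : forall u v1 v2, 0 <= u <= K -> 0 <= v1 -> v1 <= v2 -> v2 <= K ->
  f u v1 <= f u v2.
Hypothesis f00 : f 0 0 = 0.
Hypothesis phi_profile : profile K phi.
Hypothesis psi_profile : profile K psi.
Hypothesis phi_eq : forall x : R,
  is_derive x (1 : R) phi ((d * Delta1 phi x + f (phi x) (psi x)) / c).
Hypothesis phiNy : phi x @[x --> -oo] --> 0.
Hypothesis phiy : phi x @[x --> +oo] --> K.

Let phi_cont A : {within A, continuous phi}.
Proof.
apply: continuous_subspaceT => x; apply: differentiable_continuous.
by apply/derivable1_diffP; case: (phi_eq x).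
Qed.

(* Only differentiability of [f (., v)] at the single point [phi x0] is
   available, so Gronwall's inequality is run backwards from [x0]. *)
Let stationary_left x0 : d * Delta1 phi x0 + f (phi x0) (psi x0) = 0 ->
  forall x, x <= x0 -> phi x = phi x0.
Proof.
have [nd b] := phi_profile; have [ndpsi bpsi] := psi_profile.
move=> F0 x xx0; apply/le_anti; rewrite nd//=.
have [C [C0 HC]] := f_lip (conj (b x0) (bpsi x0)).
(* To the left of [x0], moving from [y] to [x0] costs [2 * d] through the central term of [Delta1]
   and [C] through [f]; the other terms are monotone. Hence [phi' + k (phi - phi x0) <= 0], so that
   [w] is nonincreasing and vanishes at [x0]. *)
pose k := (2 * d + C) / c.
pose w y := (phi y - phi x0) * expR (k * y).
pose dw y := (d * Delta1 phi y + f (phi y) (psi y)) / c * expR (k * y)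
  + (phi y - phi x0) * (k * expR (k * y)).
have Dw (y : R) : is_derive y (1 : R) w (dw y).
  have D1 : is_derive y (1 : R) (fun y => phi y - phi x0)
      ((d * Delta1 phi y + f (phi y) (psi y)) / c).
    by rewrite -[X in is_derive _ _ _ X]subr0; apply: is_deriveB.
  have D2 : is_derive y (1 : R) (fun y => expR (k * y)) (k * expR (k * y)).
    have Dk : is_derive y (1 : R) (fun y => k * y) k.
      by rewrite -[X in is_derive _ _ _ X]mulr1; exact: is_deriveZ.
    by rewrite mulrC; exact: (is_derive1_comp (is_derive_expR (k * y)) Dk).
  apply: (is_derive_eq (is_deriveM D1 D2)).
  by rewrite addrC /dw -![_ *: _]/(_ * _) [X in X + _]mulrC.
have wle y : y \in `]x, x0[ -> dw y <= 0.
  rewrite in_itv/= => /andP[_ /ltW yx0].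
  rewrite /dw mulrA -mulrDl; apply: mulr_le0_ge0; last exact: expR_ge0.
  rewrite -[leRHS](mul0r c^-1) /k mulrA -mulrDl.
  apply: ler_wpM2r; first by rewrite invr_ge0 ltW.
  have h1 := nd _ _ yx0.
  have h2 : phi (y + 1) <= phi (x0 + 1) by rewrite nd// lerD2r.
  have h3 : phi (y - 1) <= phi (x0 - 1) by rewrite nd// lerD2r.
  have /andP[p1 p2] := bpsi y; have /andP[q1 q2] := bpsi x0.
  have h4 : f (phi y) (psi y) <= f (phi y) (psi x0).
    by apply: f_homo => //; exact: ndpsi.
  have /ler_normlP[_] := HC (phi y) (b y).
  rewrite distrC ger0_norm ?subr_ge0// => h5.
  have h2d := ler_wpM2l (ltW d0) h2; have h3d := ler_wpM2l (ltW d0) h3.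
  move: F0; rewrite /Delta1 => F0.
  lra.
have w_cont : {within `[x, x0], continuous w}.
  apply: continuous_subspaceT => y; apply: differentiable_continuous.
  by apply/derivable1_diffP; case: (Dw y).
have := @ler0_derive1_le_cc R w x x0 _ _ w_cont x0 x.
rewrite !in_itv/= !lexx xx0 => /(_ _ _ isT isT isT).
rewrite /w subrr mul0r pmulr_lge0 ?expR_gt0// subr_ge0; apply.
  by move=> y _; case: (Dw y).
by move=> y yI; rewrite derive1E (@derive_val _ _ _ _ _ _ _ (Dw y)) wle.
Qed.

(** A critical point forces [phi = 0] on a left half-line. The advanced term [phi (x + 1)] then
    carries this zero to the right without bound, against the limit [K]. *)
Lemma phi_derive_gt0 x0 : 0 < (d * Delta1 phi x0 + f (phi x0) (psi x0)) / c.
Proof.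
have [nd b] := phi_profile; have [ndpsi bpsi] := psi_profile.
rewrite lt_neqAle (homo_derive_ge0 nd (phi_eq x0)) andbT eq_sym.
apply/negP => /eqP F0.
have {}F0 : d * Delta1 phi x0 + f (phi x0) (psi x0) = 0.
  by move/eqP: F0; rewrite mulf_eq0 invr_eq0 (gt_eqF c0) orbF => /eqP.
have left_cst := stationary_left F0.
have zero x : phi x <= 0 -> phi x = 0.
  by move=> xle; apply/le_anti; rewrite xle; case/andP: (b x).
have phix0 : phi x0 = 0.
  rewrite -(cvg_lim (@norm_hausdorff _ _) phiNy); apply/esym/cvg_lim => //.
  apply: cvg_near_cst; near=> x; apply: left_cst; near: x.
  by apply: nbhs_ninfty_le; exact: num_real.
(* The mean value theorem on [[y - 1/2, y]] gives a critical [z] where the equation reduces to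
   [d * phi (z + 1) + f 0 (psi z) = 0]. Both terms are nonnegative, hence [phi (z + 1) = 0], and
   [z + 1] lies beyond [y + 1/2]. *)
have step y : phi y = 0 -> phi (y + 2^-1) = 0.
  move=> phiy0; have y2 : y - 2^-1 < y by lra.
  have [z] := MVT y2 (fun z _ => phi_eq z) (@phi_cont _).
  rewrite in_itv/= => /andP[yz zy].
  have phiz t : t <= y -> phi t = 0 by move=> ty; apply: zero; rewrite -phiy0 nd.
  rewrite (phiz y)// (phiz (y - 2^-1)) ?(ltW y2)//.
  move/eqP; rewrite subrr eq_sym !mulf_eq0 invr_eq0 (gt_eqF c0) orbF.
  rewrite subr_eq0 (gt_eqF y2) orbF => /eqP.
  have pz1 : phi (z - 1) = 0 by apply: phiz; lra.
  rewrite /Delta1 pz1 (phiz z (ltW zy)).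
  have /andP[q0 qK] := bpsi z.
  have : 0 <= f 0 (psi z) by rewrite -[leLHS]f00; apply: f_homo => //; rewrite lexx ltW.
  have /andP[p0 _] := b (z + 1).
  move=> f0 eq0; have phiz1 : phi (z + 1) <= 0.
    by rewrite -(pmulr_rle0 _ d0); lra.
  by apply: zero; apply: le_trans phiz1; apply: nd; lra.
have zeros n : phi (x0 + n%:R / 2) = 0.
  elim: n => [|n IH]; first by rewrite mul0r addr0.
  by rewrite -natr1 mulrDl addrA mul1r step.
have [X [_ HX]] : \forall x \near +oo, 0 < phi x by exact: (cvgr_gt K phiy).
have x0X : x0 <= Num.max X x0 by rewrite le_max lexx orbT.
have [n Hn] : exists n : nat, Num.max X x0 + 1 <= x0 + n%:R / 2.
  have pos : 0 <= 2 * (Num.max X x0 + 1 - x0) by lra.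
  exists (Num.bound (2 * (Num.max X x0 + 1 - x0))).
  by have := archi_boundP pos; lra.
have phi_le0 : phi (Num.max X x0 + 1) <= 0 by rewrite -[leRHS](zeros n) nd.
have phi_gt0 : 0 < phi (Num.max X x0 + 1).
  by apply: HX; rewrite ltr_pwDr// le_max lexx.
by have := lt_le_trans phi_gt0 phi_le0; rewrite ltxx.
Unshelve. all: by end_near. Qed.

End strict_monotonicity.

(** * The monotone envelope of the nonlinearity *)

Section envelope.
Context {R : realType}.
Variables (K n : R) (f : R -> R -> R).

(* The least nondecreasing majorant of [u |-> f u v + n * u]; it replaces that
   function because [f (., v)] is not assumed Lipschitz. *)
Definition envelope (u v : R) : R :=
  sup [set f w v + n * w | w in [set w | 0 <= w <= u]].

Hypothesis n_ge0 : 0 <= n.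
Hypothesis f_bounded : exists B : R, 0 < B /\ forall u v, sq K u v -> `|f u v| <= B.

Lemma envelope_ge w u v : 0 <= w <= u -> u <= K -> 0 <= v <= K ->
  f w v + n * w <= envelope u v.
Proof.
move=> wu uK vK; have [B [_ HB]] := f_bounded.
apply: ub_le_sup; last by exists w.
exists (B + n * K) => _ [z /= /andP[z0 zu] <-].
have zK : z <= K := le_trans zu uK.
apply: lerD; last exact: ler_wpM2l.
by rewrite (le_trans (ler_norm _))// HB//; split=> //; rewrite z0.
Qed.

Lemma envelope_le b u v : 0 <= u ->
  (forall w, 0 <= w <= u -> f w v + n * w <= b) -> envelope u v <= b.
Proof.
move=> u0 le_b; apply: ge_sup => [|_ [w /= wu <-]]; last exact: le_b.
by exists (f 0 v + n * 0); exists 0; rewrite //= lexx.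
Qed.

Lemma envelope_homo u1 u2 v1 v2 :
  (forall u v1 v2, 0 <= u <= K -> 0 <= v1 -> v1 <= v2 -> v2 <= K -> f u v1 <= f u v2) ->
  0 <= u1 -> u1 <= u2 -> u2 <= K -> 0 <= v1 -> v1 <= v2 -> v2 <= K ->
  envelope u1 v1 <= envelope u2 v2.
Proof.
move=> f_homo u10 u12 u2K v10 v12 v2K; apply: envelope_le => // w /andP[w0 wu1].
have wu2 : w <= u2 := le_trans wu1 u12.
apply: (@le_trans _ _ (f w v2 + n * w)).
  by rewrite lerD2r f_homo// w0 (le_trans wu2).
by apply: envelope_ge; rewrite ?w0// (le_trans v10 v12).
Qed.

End envelope.

(** If [w] is within [r] of [u], uniform continuity applies. If it is farther, the loss
    [n * (u - w)] is at least [2 * B] and outweighs any variation of [f]. *)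
Lemma envelope_approx {R : realType} (K : R) (f : R -> R -> R) (e : R) :
  (exists B : R, 0 < B /\ forall u v, sq K u v -> `|f u v| <= B) ->
  (forall e : R, 0 < e -> exists r : R, 0 < r /\
    forall u v u' v', sq K u v -> sq K u' v' -> `|u - u'| <= r -> `|v - v'| <= r ->
    `|f u v - f u' v'| <= e) ->
  0 < e -> exists N : R, forall n, N <= n -> forall u v, sq K u v ->
  envelope n f u v <= f u v + n * u + e.
Proof.
move=> [B [B0 HB]] unif e0; have [r [r0 Hr]] := unif _ e0.
exists (2 * B / r) => n nN u v uv; have [/andP[u0 uK] vK] := uv.
have n0 : 0 <= n by apply: le_trans nN; rewrite divr_ge0 ?mulr_ge0 ?ltW.
apply: envelope_le => // w /andP[w0 wu].
have wv : sq K w v by split=> //; rewrite w0 (le_trans wu).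
have [uw|uw] := lerP (u - w) r.
  have : `|f w v - f u v| <= e.
    apply: Hr; rewrite // ?subrr ?normr0; last exact: ltW.
    by rewrite distrC ger0_norm// subr_ge0.
  move=> /ler_normlP[_]; have := ler_wpM2l n0 wu; lra.
have /ler_normlP[_ h1] := HB _ _ wv; have /ler_normlP[h2 _] := HB _ _ uv.
have h3 : 2 * B <= n * (u - w).
  rewrite ler_pdivrMr// in nN; apply: le_trans nN _; apply: ler_wpM2l => //; exact: ltW.
lra.
Qed.

(** The Knaster-Tarski argument: the infimum [m] of all supersolutions is a supersolution, hence so
    is [T m], which gives [m <= T m]. No continuity of [T] enters. *)
Lemma fixpoint_of_prefixpoint {R : realType} (P : set (R -> R)) (T : (R -> R) -> R -> R) :
  (forall phi, P phi -> forall x, 0 <= phi x) ->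
  (forall S, S !=set0 -> S `<=` P -> P (fun x => inf [set phi x | phi in S])) ->
  (forall phi, P phi -> P (T phi)) ->
  (forall phi psi, P phi -> P psi -> (forall x, phi x <= psi x) ->
    forall x, T phi x <= T psi x) ->
  (exists2 phi, P phi & forall x, T phi x <= phi x) ->
  exists2 phi, P phi & forall x, T phi x = phi x.
Proof.
move=> P0 Pinf TP Thomo [u Pu Tu].
pose S := [set phi | P phi /\ forall x, T phi x <= phi x].
pose m x := inf [set phi x | phi in S].
have S0 : S !=set0 by exists u.
have Pm : P m by apply: Pinf => // phi [].
have m_le phi x : S phi -> m x <= phi x.
  move=> Sphi; apply: ge_inf; last by exists phi.
  by exists 0 => _ [psi [Ppsi _] <-]; exact: P0.
have Tm x : T m x <= m x.
  apply: lb_le_inf; first by exists (u x), u.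
  move=> _ [phi Sphi <-]; have [Pphi Tphi] := Sphi.
  by apply: le_trans (Tphi x); apply: Thomo => // y; exact: m_le.
exists m => // x; apply/le_anti; rewrite Tm/=.
by apply: m_le; split; [exact: TP|move=> y; apply: Thomo => //; exact: TP].
Qed.

Lemma profile_inf {R : realType} (K : R) (lo up : R -> R) (S : set (R -> R)) :
  S !=set0 ->
  (forall phi, S phi -> profile K phi /\ forall x, lo x <= phi x <= up x) ->
  let m x := inf [set phi x | phi in S] in
  profile K m /\ forall x, lo x <= m x <= up x.
Proof.
move=> [u Su] HS m.
have m_le phi x : S phi -> m x <= phi x.
  move=> Sphi; apply: ge_inf; last by exists phi.
  by exists 0 => _ [psi /HS[[_ /(_ x)/andP[]]] + _ _ <-].
have le_m b x : (forall phi, S phi -> b <= phi x) -> b <= m x.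
  move=> leb; apply: lb_le_inf; first by exists (u x), u.
  by move=> _ [phi Sphi <-]; exact: leb.
have [[ndu bu] lu] := HS _ Su.
split; first split.
- move=> x y xy; apply: le_m => phi Sphi; apply: le_trans (m_le _ _ Sphi) _.
  by have [[+ _] _] := HS _ Sphi; apply.
- move=> x; apply/andP; split.
    by apply: le_m => phi /HS[[_ /(_ x)/andP[]]].
  by apply: le_trans (m_le _ _ Su) _; case/andP: (bu x).
- move=> x; apply/andP; split.
    by apply: le_m => phi /HS[_ /(_ x)/andP[]].
  by apply: le_trans (m_le _ _ Su) _; case/andP: (lu x).
Qed.

(** * Super- and subsolutions of the discretised equation *)

Section discrete_scheme.
Context {R : realType}.
Variables (h : R -> R) (lam0 : \bar R) (K c d a dl d1 d2 : R) (g : R -> R -> R).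
Notation mu := (@lebesgue_measure R).
Hypothesis h_ge0 : forall x, 0 <= h x.
Hypothesis h_even : forall x, h (- x) = h x.
Hypothesis h_int : mu.-integrable setT (EFin \o h).
Hypothesis h_mass : (\int[mu]_x (h x)%:E = 1)%E.
Hypothesis h_exp : forall lam : R, (lam%:E < lam0)%E ->
  (\int[mu]_(x in `[0%R, +oo[) (h x * expR (lam * x))%:E < +oo)%E.
Hypotheses (K0 : 0 < K) (c0 : 0 < c) (d0 : 0 < d) (dl0 : 0 < dl) (d20 : 0 <= d2).

(** With [y = x - dl] and [n = c / dl - 2 * d], a fixed point satisfies [c / dl * (phi (y + dl) -
    phi y) = d * Delta1 phi y + g - n * phi y]. Here [g] stands for [f + n * u] made monotone, so
    every coefficient of the scheme is nonnegative. *)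
Definition scheme (phi : R -> R) (x : R) : R :=
  dl / c * (d * (phi (x - dl + 1) + phi (x - dl - 1))
            + g (phi (x - dl)) (convol h phi (x - dl - a))).

Definition characteristic (l : R) : R :=
  d * (expR l + expR (- l) - 2) + d1 + d2 * expR (- l * a) * Gfun h l.

(** Inserting [e^(l x)] into the linearised scheme; the first term is the symbol of the forward
    difference. *)
Definition dispersion (l : R) : R :=
  c * ((expR (l * dl) - 1) / dl) - characteristic l.

Let n := c / dl - 2 * d.

Hypothesis nd1_ge0 : 0 <= n + d1.
Hypothesis g_homo : forall u1 u2 v1 v2,
  0 <= u1 -> u1 <= u2 -> u2 <= K -> 0 <= v1 -> v1 <= v2 -> v2 <= K -> g u1 v1 <= g u2 v2.
Hypothesis g00 : 0 <= g 0 0.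
Hypothesis gKK : g K K <= n * K.
Hypothesis g_up : forall u v, sq K u v -> g u v <= (n + d1) * u + d2 * v.

Let k := dl / c.
Let k0 : 0 < k. Proof. exact: divr_gt0. Qed.

Lemma scheme_le phi psi x y : profile K phi -> profile K psi ->
  (forall z, phi (x + z) <= psi (y + z)) -> scheme phi x <= scheme psi y.
Proof.
move=> pphi ppsi le; rewrite /scheme ler_pM2l//.
apply: lerD; first by rewrite ler_pM2l// lerD// -!addrA.
have /andP[? ?] := convol_itv h_ge0 h_int h_mass (x - dl - a) pphi.
have /andP[? ?] := convol_itv h_ge0 h_int h_mass (y - dl - a) ppsi.
have /andP[? ?] := pphi.2 (x - dl); have /andP[? ?] := ppsi.2 (y - dl).
by apply: g_homo => //; apply: convol_le pphi ppsi _ => // z; rewrite -!addrA.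
Qed.

Lemma scheme_ge0 phi x : profile K phi -> 0 <= scheme phi x.
Proof.
move=> pphi; rewrite /scheme; apply: mulr_ge0; first exact: ltW.
have b := pphi.2; apply: addr_ge0.
  have /andP[? _] := b (x - dl + 1); have /andP[? _] := b (x - dl - 1).
  by apply: mulr_ge0; [exact: ltW|exact: addr_ge0].
apply: le_trans g00 _.
have /andP[? ?] := convol_itv h_ge0 h_int h_mass (x - dl - a) pphi.
by have /andP[? ?] := b (x - dl); apply: g_homo.
Qed.

Lemma scheme_profile phi : profile K phi -> profile K (scheme phi).
Proof.
move=> pphi; split=> [x y xy|x].
  by apply: scheme_le => // z; apply: pphi.1; rewrite lerD2r.
apply/andP; split; first exact: scheme_ge0.
have pK : profile K (fun=> K) by apply: profile_cst; rewrite lexx ltW.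
apply: (@le_trans _ _ (scheme (fun=> K) x)).
  by apply: scheme_le => // z; case/andP: (pphi.2 (x + z)).
rewrite /scheme convol_cst//.
apply: (@le_trans _ _ (dl / c * (d * (K + K) + n * K))).
  by rewrite ler_pM2l// lerD2l.
rewrite le_eqVlt /n; apply/orP; left; apply/eqP; field.
by rewrite !gt_eqF.
Qed.

Section weighted.
Variable l : R.
Hypothesis l_ge0 : 0 <= l.
Hypothesis l_lt : (l%:E < lamplus d2 lam0)%E.

Let lt_lam0 : 0 < d2 -> (`|l|%:E < lam0)%E.
Proof. by move=> d2pos; move: l_lt; rewrite /lamplus d2pos ger0_norm. Qed.

Let d2_cases : d2 = 0 \/ 0 < d2.
Proof. by move: d20; rewrite le_eqVlt => /orP[/eqP <-|]; [left|right]. Qed.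

(** The factor [d2] is kept because [lamplus] bounds [l] by [lam0] only for [d2 > 0]; for [d2 = 0]
    no exponential moment at [l] is available, and both sides vanish. *)
Lemma weighted_convol_le phi x : profile K phi -> (forall y, phi y <= K * expR (l * y)) ->
  d2 * convol h phi (x - a) <= K * expR (l * x) * (d2 * expR (- l * a) * Gfun h l).
Proof.
move=> pphi le; have [->|d2pos] := d2_cases; first by rewrite !mul0r mulr0.
have := convol_le_expR h_ge0 h_even h_int h_exp (x - a) (lt_lam0 d2pos) pphi le.
move=> /(ler_wpM2l d20) /le_trans; apply.
rewrite mulrBr expRD -mulNr le_eqVlt; apply/orP; left; apply/eqP; ring.
Qed.

Lemma scheme_le_exp phi x : dispersion l = 0 -> profile K phi ->
  (forall y, phi y <= K * expR (l * y)) -> scheme phi x <= K * expR (l * x).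
Proof.
move=> D0 pphi le; rewrite /scheme; set y := x - dl.
have xE : x = y + dl by rewrite /y subrK.
pose E := K * expR (l * y).
have h1 : phi (y + 1) <= E * expR l.
  by apply: le_trans (le _) _; rewrite mulrDr mulr1 expRD mulrA.
have h2 : phi (y - 1) <= E * expR (- l).
  by apply: le_trans (le _) _; rewrite mulrDr mulrN1 expRD mulrA.
have h3 := weighted_convol_le y pphi le.
have h4 : g (phi y) (convol h phi (y - a)) <= (n + d1) * phi y + d2 * convol h phi (y - a).
  by apply: g_up; split; [exact: pphi.2|exact: convol_itv pphi].
have h5 : (n + d1) * phi y <= (n + d1) * E by apply: ler_wpM2l => //; exact: le.
apply: (@le_trans _ _ (dl / c * (E * (characteristic l + c / dl)))).
  rewrite ler_pM2l//.
  have h6 : d * (phi (y + 1) + phi (y - 1)) <= d * (E * expR l + E * expR (- l)).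
    by rewrite ler_pM2l// lerD.
  rewrite /characteristic; move: h3 h4 h5 h6; rewrite -/E /n.
  set GG := d2 * _ * _; move=> h3 h4 h5 h6; lra.
move/eqP: D0; rewrite subr_eq0 => /eqP <-.
rewrite xE [l * (_ + _)]mulrDr expRD [K * (_ * _)]mulrA -/E.
rewrite le_eqVlt; apply/orP; left; apply/eqP; field.
by rewrite !gt_eqF.
Qed.

End weighted.

Variables (l1 l2 N : R).
Hypothesis l1_gt0 : 0 < l1.
Hypothesis l12 : l1 < l2.
Hypothesis l2_lt : (l2%:E < lamplus d2 lam0)%E.
Hypothesis D1 : dispersion l1 = 0.
Hypothesis D2 : 0 < dispersion l2.
Hypothesis N0 : 0 <= N.
Hypothesis g_low : forall phi x, profile K phi -> (forall y, phi y <= K * expR (l1 * y)) ->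
  x <= 0 -> (n + d1) * phi x + d2 * convol h phi (x - a) - N * expR (l2 * x)
            <= g (phi x) (convol h phi (x - a)).

Let l1_lt : (l1%:E < lamplus d2 lam0)%E.
Proof. by apply: lt_trans l2_lt; rewrite lte_fin. Qed.

(** Chosen so that [(q - 1) * K * dispersion l2 = N], the size of the nonlinear defect; the summand
    1 makes [lo] nonpositive on the right half-line. *)
Let q := 1 + N / (K * dispersion l2).
Let lo x := K * (expR (l1 * x) - q * expR (l2 * x)).

Let q_ge1 : 1 <= q.
Proof. by rewrite /q lerDl divr_ge0// ltW// mulr_gt0. Qed.

Let lo_le0 x : 0 <= x -> lo x <= 0.
Proof.
move=> x0; apply: mulr_ge0_le0; first exact: ltW.
rewrite subr_le0; apply: (@le_trans _ _ (expR (l2 * x))).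
  by rewrite ler_expR; apply: ler_wpM2r => //; exact: ltW.
by rewrite ler_peMl// expR_ge0.
Qed.

Lemma weighted_convol_ge phi x : profile K phi -> (forall y, lo y <= phi y) ->
  K * (expR (l1 * x) * (d2 * expR (- l1 * a) * Gfun h l1)
       - q * (expR (l2 * x) * (d2 * expR (- l2 * a) * Gfun h l2)))
  <= d2 * convol h phi (x - a).
Proof.
move=> pphi le; move: d20; rewrite le_eqVlt => /orP[/eqP <-|d2pos].
  by rewrite !mul0r !mulr0 subrr mulr0.
have lt1 : (`|l1|%:E < lam0)%E.
  by move: l1_lt; rewrite /lamplus d2pos gtr0_norm.
have lt2 : (`|l2|%:E < lam0)%E.
  by move: l2_lt; rewrite /lamplus d2pos gtr0_norm// (lt_trans l1_gt0).
have := convol_ge_expR h_ge0 h_even h_int h_exp (x - a) lt1 lt2 pphi le.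
move=> /(ler_wpM2l d20); apply: le_trans.
rewrite !mulrBr !expRD -!mulNr le_eqVlt; apply/orP; left; apply/eqP; ring.
Qed.

(** For [x < 0] the linear part reproduces the [l1] term, since [dispersion l1 = 0]. The [l2] term,
    which is subtracted, shrinks by [q * K * dispersion l2 * e^(l2 y)]: the share [q - 1] pays for
    the defect and the remaining share is positive. *)
Let scheme_ge_lo phi x : profile K phi -> (forall y, lo y <= phi y <= K * expR (l1 * y)) ->
  lo x <= scheme phi x.
Proof.
move=> pphi bphi.
have [x0|x0] := lerP 0 x.
  by apply: le_trans (lo_le0 x0) _; exact: scheme_ge0.
have ge y : lo y <= phi y by case/andP: (bphi y).
have le y : phi y <= K * expR (l1 * y) by case/andP: (bphi y).
rewrite /scheme; set y := x - dl.
have xE : x = y + dl by rewrite /y subrK.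
have y0 : y <= 0 by rewrite /y subr_le0 (le_trans (ltW x0))// ltW.
clearbody y.
have h0 := g_low pphi le y0.
have h3 := weighted_convol_ge y pphi ge.
have h1 := ge (y + 1); have h2 := ge (y - 1).
have h5 : (n + d1) * lo y <= (n + d1) * phi y by apply: ler_wpM2l.
have hd : d * (lo (y + 1) + lo (y - 1)) <= d * (phi (y + 1) + phi (y - 1)).
  by rewrite ler_pM2l// lerD.
pose E1 := expR (l1 * y); pose E2 := expR (l2 * y).
have E20 : 0 < E2 := expR_gt0 _.
have qN : N = (q - 1) * (K * dispersion l2).
  by rewrite /q addrAC subrr add0r divfK// gt_eqF// mulr_gt0.
have KD : 0 < K * dispersion l2 by rewrite mulr_gt0.
apply: (@le_trans _ _ (dl / c * (K * E1 * (characteristic l1 + c / dl)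
   - q * K * E2 * (characteristic l2 + c / dl) - N * E2))); last first.
  rewrite ler_pM2l//; apply: le_trans (lerD hd h0).
  move: h3 h5; rewrite /lo /characteristic -/E1 -/E2 /n !mulrDr !expRD !mulr1 !mulrN1 -/E1 -/E2.
  set G1 := d2 * _ * _; set G2 := d2 * _ * _; set e1 := expR l1; set e2 := expR l2.
  set f1 := expR (- l1); set f2 := expR (- l2).
  move=> h3 h5; lra.
have loxE : lo x = dl / c * (K * E1 * (characteristic l1 + dispersion l1 + c / dl)
   - q * K * E2 * (characteristic l2 + dispersion l2 + c / dl)).
  rewrite /lo /dispersion ![_ + (_ - characteristic _)]addrC !subrK xE !mulrDr !expRD -/E1 -/E2.
  by field; rewrite !gt_eqF.
rewrite loxE D1 addr0 ler_pM2l// qN.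
have -> : q * K * E2 * (characteristic l2 + dispersion l2 + c / dl)
    = q * K * E2 * (characteristic l2 + c / dl) + (q - 1) * (K * dispersion l2) * E2
      + K * dispersion l2 * E2 by ring.
by rewrite opprD addrA opprD addrA gerBl mulr_ge0// ltW.
Qed.

Lemma scheme_fixpoint : exists phi, [/\ profile K phi, forall x, phi x = scheme phi x,
  forall x, phi x <= K * expR (l1 * x) & exists x, 0 < phi x].
Proof.
pose up x := K * expR (l1 * x).
pose P := [set phi : R -> R | profile K phi /\ forall x, lo x <= phi x <= up x].
have [|||||phi [pphi bphi] fixphi] := @fixpoint_of_prefixpoint R P scheme.
- by move=> phi [[_ b] _] x; case/andP: (b x).
- by move=> S S0 SP; apply: profile_inf.
- move=> phi [pphi bphi]; split; first exact: scheme_profile.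
  move=> x; rewrite scheme_ge_lo//=; apply: scheme_le_exp => //; first exact: ltW.
  by move=> y; case/andP: (bphi y).
- by move=> phi psi [pphi _] [ppsi _] le x; exact: scheme_le.
(* The largest admissible profile is a prefixpoint, both of its branches being supersolutions. *)
- pose u x := Num.min K (up x).
  have up_homo : {homo up : x y / x <= y}.
    by move=> x y xy; rewrite /up ler_pM2l// ler_expR ler_pM2l.
  have up_gt0 x : 0 < up x by rewrite /up mulr_gt0// expR_gt0.
  have pu : profile K u.
    split=> [x y xy|x]; rewrite /u.
      by rewrite le_min ge_min lexx/= ge_min up_homo ?orbT.
    by rewrite le_min (ltW K0) (ltW (up_gt0 x))/= ge_min lexx.
  have u_up x : u x <= up x by rewrite ge_min lexx orbT.
  exists u; last first.
    move=> x; rewrite le_min; apply/andP; split.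
      by have [_ /(_ x)/andP[]] := scheme_profile pu.
    by apply: scheme_le_exp => //; exact: ltW.
  split=> // x; rewrite u_up andbT le_min; apply/andP; split.
    have [x0|x0] := lerP 0 x; first exact: le_trans (lo_le0 x0) (ltW K0).
    rewrite -[leRHS]mulr1 /lo ler_pM2l// lerBlDr.
    apply: (@le_trans _ _ 1); last by rewrite lerDl mulr_ge0 ?expR_ge0// (le_trans _ q_ge1).
    by rewrite -expR0 ler_expR mulr_ge0_le0// ltW.
  by rewrite /lo /up ler_pM2l// gerDl oppr_le0 mulr_ge0 ?expR_ge0// (le_trans _ q_ge1).
exists phi; split=> //; first by move=> x; case/andP: (bphi x).
(* Here [(l2 - l1) * x < - ln q], that is [q e^(l2 x) < e^(l1 x)], so the subsolution is positive
   and the fixed point is not zero. *)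
pose x := - (ln q + 1) / (l2 - l1).
exists x; apply: lt_le_trans (_ : lo x <= _); last by case/andP: (bphi x).
have q0 : 0 < q := lt_le_trans ltr01 q_ge1.
have l21 : 0 < l2 - l1 by rewrite subr_gt0.
rewrite /lo mulr_gt0// subr_gt0 -[X in X * _ < _]lnK// -expRD ltr_expR.
have : (l2 - l1) * x = - (ln q + 1) by rewrite /x mulrC divfK// gt_eqF.
lra.
Qed.

End discrete_scheme.

(** The supremum of the points where [D <= 0]. Taking the last zero makes [D] positive immediately
    to its right, so [l2] may be chosen as close to [l1] as required. *)
Lemma last_zero {R : realType} (D : R -> R) (b : R) : 0 < b ->
  (forall l, 0 <= l <= b -> {for l, continuous D}) -> D 0 < 0 -> 0 < D b ->
  exists l1, [/\ 0 < l1, l1 < b, D l1 = 0 & forall l, l1 < l <= b -> 0 < D l].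
Proof.
move=> b0 Dcont D0 Db.
pose S := [set l | 0 <= l <= b /\ D l <= 0].
have S0 : S 0 by split; [rewrite lexx ltW|exact: ltW].
have Sb : has_sup S by split; [exists 0|exists b => l [/andP[]]].
set s := sup S.
have s_ge0 : 0 <= s by apply: (ub_le_sup Sb.2).
have s_le : s <= b by apply: ge_sup; [exists 0|move=> l [/andP[]]].
have Ds : D s <= 0.
  rewrite leNgt; apply/negP => Ds.
  have sI : 0 <= s <= b by rewrite s_ge0.
  have [r /= r0 Hr] := cvgr_gt (D s) (Dcont _ sI) _ Ds.
  have [l Sl sl] := sup_adherent r0 Sb; have [/andP[l0 lb] Dl] := Sl.
  have ls : l <= s by apply: (ub_le_sup Sb.2).
  have : 0 < D l by apply: Hr; rewrite /ball/= ger0_norm ?subr_ge0// ltrBlDr -ltrBlDl.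
  by rewrite ltNge Dl.
have pos l : s < l <= b -> 0 < D l.
  move=> /andP[sl lb]; rewrite ltNge; apply/negP => Dl.
  have Sl : S l by split=> //; rewrite lb (le_trans s_ge0 (ltW sl)).
  by have := ub_le_sup Sb.2 Sl; rewrite leNgt sl.
have sb : s < b by rewrite lt_neqAle s_le andbT; apply/eqP => sE; move: Ds; rewrite sE leNgt Db.
have Ds0 : D s = 0.
  apply/le_anti; rewrite Ds/= leNgt; apply/negP => Dsn.
  have sI : 0 <= s <= b by rewrite s_ge0.
  have [r /= r0 Hr] := cvgr_lt (D s) (Dcont _ sI) _ Dsn.
  pose l := s + Num.min (r / 2) (b - s).
  have m0 : 0 < Num.min (r / 2) (b - s) by rewrite lt_min divr_gt0//= subr_gt0.
  have mr : Num.min (r / 2) (b - s) < r by rewrite gt_min; apply/orP; left; lra.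
  have mb : Num.min (r / 2) (b - s) <= b - s by rewrite ge_min lexx orbT.
  have : 0 < D l by apply: pos; rewrite /l; apply/andP; split; lra.
  apply/negP; rewrite -leNgt; apply/ltW/Hr; rewrite /ball/= /l opprD addrA subrr sub0r normrN.
  by rewrite gtr0_norm.
exists s; split=> //.
by rewrite lt_neqAle s_ge0 andbT; apply/eqP => sE; move: D0; rewrite [X in D X]sE Ds0 ltxx.
Qed.

(** * Limits of the right-hand side at the ends of a profile *)

Section reaction.
Context {R : realType}.
Variables (h : R -> R) (K d a : R) (f : R -> R -> R).
Notation mu := (@lebesgue_measure R).
Hypothesis h_ge0 : forall x, 0 <= h x.
Hypothesis h_int : mu.-integrable setT (EFin \o h).
Hypothesis h_mass : (\int[mu]_x (h x)%:E = 1)%E.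
Hypothesis f_unif : forall e : R, 0 < e -> exists r, 0 < r /\
  forall u v u' v', sq K u v -> sq K u' v' -> `|u - u'| <= r -> `|v - v'| <= r ->
  `|f u v - f u' v'| <= e.

Definition reaction (phi : R -> R) (x : R) : R :=
  d * Delta1 phi x + f (phi x) (convol h phi (x - a)).

Variables (phi : R -> R) (F : set_system R) (l : R).
Context {FF : ProperFilter F}.
Hypothesis pphi : profile K phi.
Hypothesis philim : forall s, phi (x + s) @[x --> F] --> l.

Lemma profile_limit_itv : 0 <= l <= K.
Proof.
have cv := philim 0; apply/andP; split.
  apply: (closed_cvg _ (@closed_ge R 0) _ _ cv); apply: nearW => x /=.
  by case/andP: (pphi.2 (x + 0)).
apply: (closed_cvg _ (@closed_le R K) _ _ cv); apply: nearW => x /=.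
by case/andP: (pphi.2 (x + 0)).
Qed.

(** On the window [|y| <= A], monotonicity squeezes [phi (x - a - y)] between the translates by
    [- a - A] and [- a + A], which both tend to [l]. An arbitrary filter serves both infinities. *)
Lemma convol_cvg : convol h phi (x - a) @[x --> F] --> l.
Proof.
have lI := profile_limit_itv; have K0 : 0 <= K by case/andP: lI => /le_trans; apply.
apply/cvgrPdist_le => e e0.
have e20 : 0 < e / 2 by rewrite divr_gt0.
have [A HA] := convol_le_far h_ge0 h_int h_mass K0 e20.
have pl := profile_cst lI.
have up := philim (- a + A); have lo := philim (- a - A).
near=> x.
have h1 : phi (x + (- a + A)) <= l + e / 2.
  by apply/ltW; near: x; apply: (cvgr_lt _ up); rewrite ltrDl.
have h2 : l - e / 2 <= phi (x + (- a - A)).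
  by apply/ltW; near: x; apply: (cvgr_gt _ lo); rewrite ltrBlDr ltrDl.
have cl z : convol h (fun=> l) z = l by exact: convol_cst.
have le1 : convol h phi (x - a) <= convol h (fun=> l) 0 + 2 * (e / 2).
  apply: (HA phi _ (x - a) 0 pphi pl) => y yA; apply: le_trans h1; apply: pphi.1.
  rewrite addrA lerD2l.
  by case/ler_normlP: yA.
have le2 : convol h (fun=> l) 0 <= convol h phi (x - a) + 2 * (e / 2).
  apply: (HA _ phi 0 (x - a) pl pphi) => y yA; rewrite -lerBlDr (le_trans h2)//; apply: pphi.1.
  by rewrite addrA lerD2l lerN2 (le_trans (ler_norm _)).
by move: le1 le2; rewrite cl => le1 le2; apply/ler_normlP; split; lra.
Unshelve. all: by end_near. Qed.

Lemma reaction_cvg : reaction phi x @[x --> F] --> f l l.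
Proof.
have lI := profile_limit_itv.
have p0 : phi x @[x --> F] --> l.
  by have := philim 0; under eq_fun do rewrite addr0.
rewrite -[X in _ --> X]add0r; apply: cvgD.
  rewrite -[X in _ --> X](mulr0 d); apply: cvgM; first exact: cvg_cst.
  rewrite (_ : 0 = l - 2 * l + l); last by ring.
  apply: cvgD; last exact: philim.
  by apply: cvgB; [exact: philim|apply: cvgM => //; exact: cvg_cst].
apply/cvgrPdist_le => e e0; have [r [r0 Hr]] := f_unif e0.
have /cvgrPdist_le /(_ _ r0) near1 := p0.
have /cvgrPdist_le /(_ _ r0) near2 := convol_cvg.
near=> x; apply: Hr.
- by [].
- by split; [exact: pphi.2|exact: convol_itv pphi].
- by near: x.
- by near: x.
Unshelve. all: by end_near. Qed.

End reaction.

(** * Waves of the discretised problem *)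

Section discrete_wave.
Context {R : realType}.
Variables (h : R -> R) (lam0 : \bar R) (K c d a d1 d2 M sigma lams : R) (f : R -> R -> R).
Notation mu := (@lebesgue_measure R).
Hypothesis h_ge0 : forall x, 0 <= h x.
Hypothesis h_even : forall x, h (- x) = h x.
Hypothesis h_int : mu.-integrable setT (EFin \o h).
Hypothesis h_mass : (\int[mu]_x (h x)%:E = 1)%E.
Hypothesis h_exp : forall lam : R, (lam%:E < lam0)%E ->
  (\int[mu]_(x in `[0%R, +oo[) (h x * expR (lam * x))%:E < +oo)%E.
Hypotheses (K0 : 0 < K) (c0 : 0 < c) (d0 : 0 < d).
Hypotheses (d2_ge0 : 0 <= d2) (d12_gt0 : 0 < d1 + d2).
Hypothesis f_bounded : exists B : R, 0 < B /\ forall u v, sq K u v -> `|f u v| <= B.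
Hypothesis f_unif : forall e : R, 0 < e -> exists r, 0 < r /\
  forall u v u' v', sq K u v -> sq K u' v' -> `|u - u'| <= r -> `|v - v'| <= r ->
  `|f u v - f u' v'| <= e.
Hypothesis f_lipK : exists C, 0 < C /\
  forall w, 0 <= w <= K -> `|f w K - f K K| <= C * `|w - K|.
Hypothesis f_homo : forall u v1 v2, 0 <= u <= K -> 0 <= v1 -> v1 <= v2 -> v2 <= K ->
  f u v1 <= f u v2.
Hypotheses (f00 : f 0 0 = 0) (fKK : f K K = 0) (f_gt0 : forall u, 0 < u < K -> 0 < f u u).
Hypotheses (M0 : 0 < M) (sigma0 : 0 < sigma).
Hypothesis f_lin : forall u v, sq K u v ->
  0 <= d1 * u + d2 * v - f u v <= M * (u + v) `^ (1 + sigma).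
Hypotheses (lams0 : 0 < lams) (lams_lt : (lams%:E < lamplus d2 lam0)%E).
Hypothesis lams_eq : c * lams = characteristic h d a d1 d2 lams.

Lemma characteristic_continuous l : 0 <= l <= lams ->
  {for l, continuous (characteristic h d a d1 d2)}.
Proof.
move=> /andP[l0 llams].
have cexp (r : R) : expR (x * r) @[x --> l] --> expR (l * r).
  apply: continuous_comp; last exact: continuous_expR.
  by apply: cvgM; [exact: cvg_id|exact: cvg_cst].
have cexp1 : expR x @[x --> l] --> expR l by exact: continuous_expR.
have cexpN : expR (- x) @[x --> l] --> expR (- l).
  by apply: continuous_comp; [exact: (cvgN cvg_id)|exact: continuous_expR].
have cexpNa : expR (- x * a) @[x --> l] --> expR (- l * a).
  apply: continuous_comp; last exact: continuous_expR.
  by apply: cvgM; [exact: (cvgN cvg_id)|exact: cvg_cst].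
rewrite /continuous_at /characteristic; apply: cvgD.
  apply: cvgD; last exact: cvg_cst.
  apply: cvgM; first exact: cvg_cst.
  by apply: cvgB; [exact: cvgD|exact: cvg_cst].
move: d2_ge0; rewrite le_eqVlt => /orP[/eqP <-|d2pos].
  by rewrite !mul0r; under eq_fun do rewrite !mul0r; exact: cvg_cst.
apply: cvgM; first by apply: cvgM; [exact: cvg_cst|].
apply: (Gfun_continuous h_ge0 h_even h_int h_exp).
by move: lams_lt; rewrite /lamplus d2pos ger0_norm//; apply: le_lt_trans; rewrite lee_fin.
Qed.

(** The dispersion equals [- (d1 + d2) < 0] at 0, and it is positive at [lams] because
    [e^t > 1 + t]. The bound [l2 <= (1 + sigma) * l1] lets [e^(l2 x)] absorb a defect of order
    [1 + sigma]. *)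
Lemma dispersion_roots dl : 0 < dl -> exists l1 l2, [/\ 0 < l1, l1 < l2 <= lams,
  l2 <= (1 + sigma) * l1,
  dispersion h c d a dl d1 d2 l1 = 0 & 0 < dispersion h c d a dl d1 d2 l2].
Proof.
move=> dl0; set D := dispersion h c d a dl d1 d2.
have [||||l1 [l1_gt0 l1b Dl1 Dpos]] := @last_zero R D lams.
- by [].
- move=> l lI; apply: cvgB; last exact: characteristic_continuous.
  apply: cvgM; first exact: cvg_cst.
  apply: cvgM; last exact: cvg_cst.
  apply: cvgB; last exact: cvg_cst.
  apply: continuous_comp; last exact: continuous_expR.
  by apply: cvgM; [exact: cvg_id|exact: cvg_cst].
- rewrite /D /dispersion /characteristic oppr0 !mul0r expR0 subrr mul0r mulr0.
  have -> : Gfun h 0 = 1.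
    rewrite /Gfun -(Rintegral_kernel h_mass); apply: eq_Rintegral => x _.
    by rewrite oppr0 mul0r expR0 mulr1.
  by move: d12_gt0; lra.
- rewrite /D /dispersion -lams_eq -mulrBr mulr_gt0// subr_gt0 ltr_pdivlMr// ltrBrDl.
  by apply: expR_gt1Dx; rewrite gt_eqF// mulr_gt0.
exists l1, (Num.min lams ((1 + sigma) * l1)).
have l1s : l1 < (1 + sigma) * l1 by rewrite ltr_pMl// ltrDl.
have l12 : l1 < Num.min lams ((1 + sigma) * l1) by rewrite lt_min l1b.
split=> //; rewrite ?l12 ?ge_min ?lexx ?orbT //.
by apply: Dpos; rewrite l12/= ge_min lexx.
Qed.

Lemma f_lower (l1 : R) : 0 < l1 -> l1 < lams -> exists S, 0 <= S /\
  forall phi x, profile K phi -> (forall y, phi y <= K * expR (l1 * y)) ->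
  d1 * phi x + d2 * convol h phi (x - a) - M * (expR (l1 * x) * S) `^ (1 + sigma)
    <= f (phi x) (convol h phi (x - a)).
Proof.
move=> l1_gt0 l1_lt.
have s0 : 0 <= 1 + sigma by rewrite addr_ge0// ltW.
have conv_itv phi x (pphi : profile K phi) := convol_itv h_ge0 h_int h_mass x pphi.
have powle u v S x : 0 <= u -> 0 <= v -> u + v <= expR (l1 * x) * S ->
    M * (u + v) `^ (1 + sigma) <= M * (expR (l1 * x) * S) `^ (1 + sigma).
  move=> u0 v0 uv; rewrite ler_pM2l//; apply: ge0_ler_powR => //.
    by rewrite nnegrE addr_ge0.
  by rewrite nnegrE (le_trans _ uv)// addr_ge0.
(* Without an exponential moment the convolution has no exponential bound, so for [d2 = 0]
   monotonicity in [v] is used to compare with [f (u, 0)]. *)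
move: (d2_ge0); rewrite le_eqVlt => /orP[/eqP d2E|d2pos].
  exists K; split=> [|phi x pphi le]; first exact: ltW.
  have /andP[v0 vK] := conv_itv phi (x - a) pphi; have uK := pphi.2 x.
  have /andP[u0 _] := uK.
  rewrite -d2E mul0r addr0.
  apply: (@le_trans _ _ (f (phi x) 0)); last exact: f_homo.
  have u0sq : sq K (phi x) 0 by split=> //; rewrite lexx ltW.
  have /andP[_] := f_lin u0sq; rewrite mulr0 addr0.
  have le0 : phi x + 0 <= expR (l1 * x) * K by rewrite addr0 mulrC.
  have := powle _ _ _ _ u0 (lexx 0) le0; lra.
have lt1 : (`|l1|%:E < lam0)%E.
  by move: lams_lt; rewrite /lamplus d2pos gtr0_norm//; apply: lt_trans; rewrite lte_fin.
exists (K + K * expR (- l1 * a) * Gfun h l1); split.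
  have K_ge0 : 0 <= K := ltW K0.
  by rewrite addr_ge0 ?mulr_ge0 ?Gfun_ge0 ?expR_ge0.
move=> phi x pphi le.
have vI := conv_itv phi (x - a) pphi; have uI := pphi.2 x.
have := f_lin (conj uI vI) => /andP[_].
have := convol_le_expR h_ge0 h_even h_int h_exp (x - a) lt1 pphi le.
rewrite mulrBr expRD -mulNr => le2.
have /andP[v0 _] := vI; have /andP[u0 _] := uI.
have le3 : phi x + convol h phi (x - a) <=
    expR (l1 * x) * (K + K * expR (- l1 * a) * Gfun h l1).
  apply: le_trans (lerD (le x) le2) _.
  by rewrite le_eqVlt; apply/orP; left; apply/eqP; ring.
have := powle _ _ _ _ u0 v0 le3; lra.
Qed.

Lemma convol_translate phi x0 x : convol h (fun y => phi (y + x0)) x = convol h phi (x + x0).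
Proof. by rewrite /convol; apply: eq_Rintegral => y _; rewrite addrAC. Qed.

Lemma profile_translate phi x0 : profile K phi -> profile K (fun y => phi (y + x0)).
Proof. by move=> [nd b]; split=> // x y xy; apply: nd; rewrite lerD2r. Qed.

(* Since the equation is translation invariant, a wave can be pinned by
   requiring it to cross the level [K / 2] at the origin. *)
Lemma discrete_wave (e : R) : 0 < e -> exists2 r, 0 < r & forall dl, 0 < dl < r ->
  exists phi, [/\ profile K phi, forall x, x < 0 -> phi x <= K / 2,
    forall x, 0 < x -> K / 2 <= phi x &
    forall x, reaction h d a f phi x <= c / dl * (phi (x + dl) - phi x)
                <= reaction h d a f phi x + e].
Proof.
move=> e0.
have [N HN] := envelope_approx f_bounded f_unif e0; have [C [C0 HC]] := f_lipK.
(* The terms serve, in order, the accuracy of the envelope, the bound [g K K <= n * K], the sign of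
   [n + d1], and the shift between [c / dl] and [n]. *)
pose n0 := `|N| + C + `|d1| + 2 * d.
have n00 : 0 < n0.
  by move: (normr_ge0 N) (normr_ge0 d1) C0 d0; rewrite /n0; lra.
exists (c / n0) => [|dl /andP[dl0 dlr]]; first exact: divr_gt0.
have n0_le : n0 <= c / dl by rewrite ler_pdivlMr// mulrC -ler_pdivlMr// ltW.
set n := c / dl - 2 * d.
have n_ge : `|N| + C + `|d1| <= n by rewrite /n lerBrDr.
have n_ge0 : 0 <= n by move: (normr_ge0 N) (normr_ge0 d1) C0; lra.
have nN : N <= n.
  have := ler_norm N; have := normr_ge0 d1; lra.
have nC : C <= n by have := normr_ge0 N; have := normr_ge0 d1; lra.
have nd1 : 0 <= n + d1.
  have := ler_norm (- d1); rewrite normrN; have := normr_ge0 N; lra.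
pose g := envelope n f.
have g_ge u v : sq K u v -> f u v + n * u <= g u v.
  by move=> [/andP[u0 uK] vK]; apply: (envelope_ge n_ge0 f_bounded) => //; rewrite u0 lexx.
have [l1 [l2 [l1_gt0 /andP[l12 l2_le] l2s D1 D2]]] := dispersion_roots dl0.
have l1_lt : l1 < lams := lt_le_trans l12 l2_le.
have [S [S0 HS]] := f_lower l1_gt0 l1_lt.
pose N' := M * S `^ (1 + sigma).
have [|||||||phi [pphi fixphi lephi [x1 x1pos]]] :=
  @scheme_fixpoint R h lam0 K c d a dl d1 d2 g h_ge0 h_even h_int h_mass h_exp
    K0 c0 d0 dl0 d2_ge0 nd1 _ _ _ _ l1 l2 N' l1_gt0 l12 _ D1 D2 _ _.
- move=> u1 u2 v1 v2; exact: envelope_homo.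
- have : sq K 0 0 by split; rewrite lexx ltW.
  by move=> /g_ge; rewrite f00 mulr0 addr0.
- apply: envelope_le; first exact: ltW.
  move=> w wK; have /andP[w0 wK'] := wK.
  have := HC w wK; rewrite fKK subr0 => /ler_normlP[_].
  rewrite distrC ger0_norm ?subr_ge0// => h1.
  rewrite -lerBrDr -mulrBr; apply: le_trans h1 _.
  by apply: ler_wpM2r => //; rewrite subr_ge0.
- move=> u v [/andP[u0 uK] vK]; apply: envelope_le => // w /andP[w0 wu].
  have /f_lin/andP[h1 _] : sq K w v by split=> //; rewrite w0 (le_trans wu).
  have := ler_wpM2l nd1 wu; rewrite -/n; lra.
- by apply: le_lt_trans lams_lt; rewrite lee_fin.
- by rewrite mulr_ge0 ?powR_ge0// ltW.
- move=> phi x pphi le x0.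
  have vI := convol_itv h_ge0 h_int h_mass (x - a) pphi; have uI := pphi.2 x.
  have := g_ge _ _ (conj uI vI); have := HS phi x pphi le.
  (* This is where [x <= 0] matters: [l2 <= (1 + sigma) * l1] then gives
     [e^((1 + sigma) l1 x) <= e^(l2 x)]. *)
  have : M * (expR (l1 * x) * S) `^ (1 + sigma) <= N' * expR (l2 * x).
    rewrite powRM ?expR_ge0// -expRM mulrC /N' -mulrA [S `^ _ * _]mulrC.
    rewrite mulrC ler_pM2l//; apply: ler_wpM2r; first exact: powR_ge0.
    by rewrite ler_expR mulrAC ler_wnM2r// mulrC.
  rewrite -/n; lra.
have lim_y : phi x @[x --> +oo] --> sup (range phi).
  apply: nondecreasing_cvgr; first exact: pphi.1.
  by exists K => _ [x _ <-]; case/andP: (pphi.2 x).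
set L := sup _ in lim_y.
have lim_ys s : phi (x + s) @[x --> +oo] --> L by rewrite (cvg_shiftr s).
have res x : reaction h d a f phi x <= c / dl * (phi (x + dl) - phi x)
    <= reaction h d a f phi x + e.
  have vI := convol_itv h_ge0 h_int h_mass (x - a) pphi; have uI := pphi.2 x.
  have -> : c / dl * (phi (x + dl) - phi x) = d * Delta1 phi x
      + (g (phi x) (convol h phi (x - a)) - n * phi x).
    rewrite [phi (x + dl)]fixphi /scheme addrK /Delta1 /n; field.
    by rewrite !gt_eqF.
  have := g_ge _ _ (conj uI vI); have := HN n nN _ _ (conj uI vI).
  by rewrite /reaction -/g => ? ?; apply/andP; split; lra.
have /andP[_ L_le] : 0 <= L <= K by exact: profile_limit_itv pphi lim_ys.
have L_gt0 : 0 < L.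
  apply: lt_le_trans x1pos _; apply: ub_le_sup; last by exists x1.
  by exists K => _ [x _ <-]; case/andP: (pphi.2 x).
(* Otherwise the increments, which tend to 0, would stay above a reaction tending to [f L L > 0]. *)
have LK : L = K.
  apply/le_anti; rewrite L_le leNgt; apply/negP => ltLK.
  have : 0 < f L L by apply: f_gt0; rewrite L_gt0.
  apply/negP; rewrite -leNgt.
  have rc : reaction h d a f phi x @[x --> +oo] --> f L L.
    exact: reaction_cvg h_ge0 h_int h_mass f_unif _ _ _ _ pphi lim_ys.
  have incr : c / dl * (phi (x + dl) - phi x) @[x --> +oo] --> 0.
    rewrite -(mulr0 (c / dl)) -(subrr L); apply: cvgM; first exact: cvg_cst.
    by apply: cvgB.
  by apply: (ler_cvg_to rc incr); apply: nearW => x; case/andP: (res x).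
pose S0' := [set x | phi x <= K / 2].
have [X HX] : exists X, forall x, S0' x -> x <= X.
  have K2 : K / 2 < L by rewrite LK; lra.
  have [X [_ HX]] := cvgr_gt _ lim_y _ K2.
  exists X => x; rewrite /S0'/=; apply: contraTle => /HX /=; by rewrite ltNge.
have S0'_mem : S0' (- ln 2 / l1).
  rewrite /S0'/=; apply: le_trans (lephi _) _.
  by rewrite [l1 * _]mulrC divfK ?gt_eqF// expRN lnK ?posrE.
(* No continuity of [phi] is known, so the level [K / 2] need not be attained and the crossing is
   expressed by inequalities on either side of [x0]. *)
pose x0 := sup S0'.
have S0'_sup : has_sup S0' by split; [exists (- ln 2 / l1)|exists X => x; exact: HX].
exists (fun x => phi (x + x0)); split.
- exact: profile_translate.
- move=> x; rewrite -oppr_gt0 => Nx; have [y S0'y xy] := sup_adherent Nx S0'_sup.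
  by apply: le_trans S0'y; apply: pphi.1; rewrite -/x0 opprK in xy; rewrite addrC ltW.
- move=> x xgt0; rewrite leNgt; apply/negP => /ltW /(ub_le_sup S0'_sup.2).
  by rewrite -/x0 gerDr leNgt xgt0.
- move=> x; have := res (x + x0).
  by rewrite /reaction /Delta1 convol_translate ![_ + x0 + _]addrAC.
Qed.

End discrete_wave.

(** * From difference quotients to increments and derivatives *)

Section telescoping.
Context {R : realType}.

(** Steps of length [dl] are summed from [x]; as [y] need not be a grid point, monotonicity compares
    it with its two neighbours, at the cost of one step. *)
Lemma telescoping (w : R -> R) (c dl x y m M : R) : {homo w : x y / x <= y} ->
  0 < c -> 0 < dl -> x <= y ->
  (forall z, x <= z <= y -> m <= c / dl * (w (z + dl) - w z) <= M) ->
  m * (y - x) - `|m| * dl <= c * (w y - w x) <= M * (y - x) + `|M| * dl.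
Proof.
move=> ndw c0 dl0 xy bnd.
(* The range extends to [y + dl] because the last step may start at or before [y] and end beyond
   it. *)
have steps (i : nat) : x + i%:R * dl <= y + dl ->
    i%:R * dl * m <= c * (w (x + i%:R * dl) - w x) <= i%:R * dl * M.
  elim: i => [_|i IH]; first by rewrite !mul0r addr0 subrr mulr0 lexx.
  rewrite -natr1 mulrDl mul1r addrA lerD2r => le_y.
  have /IH/andP[IH1 IH2] : x + i%:R * dl <= y + dl by rewrite (le_trans le_y)// lerDl ltW.
  have /bnd : x <= x + i%:R * dl <= y by rewrite le_y lerDl mulr_ge0// ltW.
  set z := x + _; rewrite mulrAC => /andP[b1 b2].
  have E : c * (w (z + dl) - w z) = dl * (c * (w (z + dl) - w z) / dl).
    by field; rewrite gt_eqF.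
  have := ler_wpM2l (ltW dl0) b1; have := ler_wpM2l (ltW dl0) b2.
  rewrite -E => h1 h2; apply/andP; split; lra.
have q0 : 0 <= (y - x) / dl by rewrite divr_ge0 ?subr_ge0// ltW.
pose i := Num.truncn ((y - x) / dl).
have /andP[i1 i2] := truncn_itv q0; rewrite -/i in i1 i2.
move: i1 i2; rewrite ler_pdivlMr// ltr_pdivrMr// -natr1 mulrDl mul1r => i1 i2.
have s1 := steps i; have s2 := steps i.+1.
move: s2; rewrite -natr1 mulrDl mul1r => s2.
have /s1/andP[s11 _] : x + i%:R * dl <= y + dl by lra.
have /s2/andP[_ s22] : x + (i%:R * dl + dl) <= y + dl by lra.
have w1 : w (x + i%:R * dl) <= w y by apply: ndw; lra.
have w2 : w y <= w (x + (i%:R * dl + dl)) by apply: ndw; lra.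
have cw1 := ler_wpM2l (ltW c0) w1; have cw2 := ler_wpM2l (ltW c0) w2.
move: s11 s22; set t := i%:R * dl => s11 s22.
have [t1 t2] : 0 <= y - x - t <= dl /\ 0 <= t + dl - (y - x) <= dl.
  by rewrite -/t in i1 i2; split; apply/andP; split; lra.
have abs_le (b r : R) : 0 <= r <= dl -> b * r <= `|b| * dl.
  move=> /andP[r0 rdl]; apply: le_trans (ler_wpM2l (normr_ge0 b) rdl).
  by apply: ler_wpM2r => //; exact: ler_norm.
have := abs_le m _ t1; have := abs_le M _ t2.
move=> a1 a2; apply/andP; split; lra.
Qed.

Lemma is_derive_of_le (phi : R -> R) (x l : R) :
  (forall e, 0 < e -> exists2 r, 0 < r & forall y, `|y - x| <= r ->
     `|phi y - phi x - l * (y - x)| <= e * `|y - x|) ->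
  is_derive x (1 : R) phi l.
Proof.
move=> H.
have cv : (fun t => t^-1 *: ((phi \o shift x) (t *: 1) - phi x)) @ 0^' --> l.
  apply/cvgrPdist_le => e e0; have [r r0 Hr] := H e e0.
  exists r => //= t; rewrite /ball/= sub0r normrN => /ltW tr t0.
  have := Hr (t + x); rewrite addrK /shift/= scaler1 => /(_ tr) le.
  rewrite -[_ *: _]/(_ * _) distrC -(ler_pM2r (_ : 0 < `|t|)) ?normr_gt0//.
  by rewrite -normrM mulrBl mulrAC mulVf// mul1r.
apply: DeriveDef; first by apply/cvg_ex; exists l.
by rewrite /derive; apply/cvg_lim.
Qed.

End telescoping.

(** * The limit of vanishing step *)

Section wave_limit.
Context {R : realType}.
Variables (h : R -> R) (K c d a : R) (f : R -> R -> R).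
Notation mu := (@lebesgue_measure R).
Hypothesis h_ge0 : forall x, 0 <= h x.
Hypothesis h_int : mu.-integrable setT (EFin \o h).
Hypothesis h_mass : (\int[mu]_x (h x)%:E = 1)%E.
Hypotheses (K0 : 0 < K) (c0 : 0 < c) (d0 : 0 < d).
Hypothesis f_bounded : exists B : R, 0 < B /\ forall u v, sq K u v -> `|f u v| <= B.
Hypothesis f_unif : forall e : R, 0 < e -> exists r, 0 < r /\
  forall u v u' v', sq K u v -> sq K u' v' -> `|u - u'| <= r -> `|v - v'| <= r ->
  `|f u v - f u' v'| <= e.

Lemma reaction_bounded : exists2 B : R, 0 < B & forall phi x, profile K phi ->
  `|reaction h d a f phi x| <= B.
Proof.
have [B [B0 HB]] := f_bounded; exists (2 * d * K + B).
  by rewrite addr_gt0// !mulr_gt0.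
move=> phi x [nd b]; rewrite /reaction /Delta1.
have /ler_normlP[f1 f2] : `|f (phi x) (convol h phi (x - a))| <= B.
  by apply: HB; split=> //; exact: convol_itv (conj nd b).
have /andP[? ?] := b x; have /andP[? ?] := b (x + 1); have /andP[? ?] := b (x - 1).
have /(ler_wpM2l (ltW d0)) D1 : phi (x + 1) - 2 * phi x + phi (x - 1) <= 2 * K by lra.
have /(ler_wpM2l (ltW d0)) D2 : - (2 * K) <= phi (x + 1) - 2 * phi x + phi (x - 1) by lra.
by apply/ler_normlP; split; lra.
Qed.

Variables (w : nat -> R -> R) (dl e : nat -> R) (U : set_system nat).
Context {UF : ProperFilter U}.
Hypothesis w_profile : forall n, profile K (w n).
Hypothesis dl_gt0 : forall n, 0 < dl n.
Hypothesis dl_cvg : dl n @[n --> U] --> 0.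
Hypothesis e_cvg : e n @[n --> U] --> 0.
Hypothesis w_eq : forall n x, reaction h d a f (w n) x
  <= c / dl n * (w n (x + dl n) - w n x) <= reaction h d a f (w n) x + e n.
Variable phi : R -> R.
Hypothesis w_cvg : forall x, w n x @[n --> U] --> phi x.

Lemma limit_profile : profile K phi.
Proof.
split=> [x y xy|x].
  apply: (ler_cvg_to (@w_cvg x) (@w_cvg y)); apply: nearW => n.
  exact: (w_profile n).1.
apply/andP; split.
  apply: (closed_cvg _ (@closed_ge R 0) _ _ (@w_cvg x)); apply: nearW => n /=.
  by case/andP: ((w_profile n).2 x).
apply: (closed_cvg _ (@closed_le R K) _ _ (@w_cvg x)); apply: nearW => n /=.
by case/andP: ((w_profile n).2 x).
Qed.

(** The rounding terms of [telescoping] vanish with [dl]. In the hypothesis, [U] under [\near]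
    denotes the index. *)
Lemma limit_increments x y m M : x <= y ->
  (\near U, forall z, x <= z <= y -> m <= c / dl U * (w U (z + dl U) - w U z) <= M) ->
  m * (y - x) <= c * (phi y - phi x) <= M * (y - x).
Proof.
move=> xy bnd.
have inc : c * (w n y - w n x) @[n --> U] --> c * (phi y - phi x).
  by apply: cvgM; [exact: cvg_cst|exact: cvgB].
have lin (b s : R) : b * (y - x) + s * dl n @[n --> U] --> b * (y - x).
  rewrite -[X in _ --> X]addr0 -(mulr0 s); apply: cvgD; first exact: cvg_cst.
  by apply: cvgM; [exact: cvg_cst|].
have tel : \forall n \near U, m * (y - x) + - `|m| * dl n <= c * (w n y - w n x)
    <= M * (y - x) + `|M| * dl n.
  near=> n; have := @telescoping R (w n) c (dl n) x y m M (w_profile n).1 c0 (dl_gt0 n) xy.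
  by rewrite -mulNr; apply; near: n.
apply/andP; split.
  by apply: (ler_cvg_to (lin m (- `|m|)) inc); apply: filterS tel => n /andP[].
by apply: (ler_cvg_to inc (lin M `|M|)); apply: filterS tel => n /andP[].
Unshelve. all: by end_near. Qed.

Lemma limit_lipschitz : exists2 L, 0 < L & forall x y, x <= y -> phi y - phi x <= L * (y - x).
Proof.
have [B B0 HB] := reaction_bounded; exists ((B + 1) / c).
  by rewrite divr_gt0// addr_gt0.
move=> x y xy.
have /andP[_] : - B * (y - x) <= c * (phi y - phi x) <= (B + 1) * (y - x).
  apply: limit_increments => //; near=> n => z _; have /ler_normlP[h1 h2] := HB _ z (w_profile n).
  have e1 : e n <= 1 by apply/ltW; near: n; exact: cvgr_lt e_cvg _ ltr01.
  by have /andP[h3 h4] := w_eq n z; apply/andP; split; lra.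
by rewrite mulrAC ler_pdivlMr// mulrC.
Unshelve. all: by end_near. Qed.

(** For monotone functions with a Lipschitz limit, closeness on a finite grid suffices: between
    neighbouring nodes both functions are trapped, and the mesh [s] satisfies [L * s = eta / 2]. *)
Lemma limit_locally_uniform A eta : 0 < eta ->
  \forall n \near U, forall x, `|x| <= A -> `|w n x - phi x| <= eta.
Proof.
move=> eta0; have [L L0 HL] := limit_lipschitz.
have eta20 : 0 < eta / 2 by rewrite divr_gt0.
pose s := eta / 2 / L; have s0 : 0 < s by rewrite divr_gt0.
pose t (i : nat) : R := - A + i%:R * s.
have grid N : \forall n \near U, forall i, (i <= N)%N -> `|phi (t i) - w n (t i)| <= eta / 2.
  elim: N => [|N IH].
    have /cvgrPdist_le /(_ _ eta20) := @w_cvg (t 0%N).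
    by apply: filterS => n le i; rewrite leqn0 => /eqP ->.
  have /cvgrPdist_le /(_ _ eta20) := @w_cvg (t N.+1).
  apply: filterS2 IH => n IH le i; rewrite leq_eqVlt => /orP[/eqP -> //|].
  exact: IH.
near=> n => x xA; have /ler_normlP[xA1 xA2] := xA.
have q0 : 0 <= (x + A) / s by rewrite divr_ge0 ?(ltW s0)//; lra.
pose i := Num.truncn ((x + A) / s).
have /andP[i1 i2] := truncn_itv q0; rewrite -/i in i1 i2.
have iN : (i.+1 <= (Num.truncn (2 * A / s)).+1)%N.
  rewrite ltnS; apply: le_truncn; rewrite ler_pM2r ?invr_gt0//; lra.
move: i1 i2; rewrite ler_pdivlMr// ltr_pdivrMr// => i1 i2.
have g : forall i, (i <= (Num.truncn (2 * A / s)).+1)%N -> `|phi (t i) - w n (t i)| <= eta / 2.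
  by near: n; exact: grid.
have /ler_normlP[g1 _] := g i (ltnW iN); have /ler_normlP[_ g2] := g i.+1 iN.
have /ler_normlP[g3 g4] := g i (ltnW iN); have /ler_normlP[g5 g6] := g i.+1 iN.
have ti : t i <= x by rewrite /t; lra.
have ti1 : x <= t i.+1 by rewrite /t; lra.
have tt : t i.+1 = t i + s by rewrite /t -natr1; ring.
have Ls : L * s = eta / 2 by rewrite /s mulrC divfK// gt_eqF.
have w1 := (w_profile n).1 _ _ ti; have w2 := (w_profile n).1 _ _ ti1.
have p1 := HL _ _ ti; have p2 := HL _ _ ti1.
have b1 : L * (x - t i) <= L * s by apply: ler_wpM2l; [exact: ltW|lra].
have b2 : L * (t i.+1 - x) <= L * s by apply: ler_wpM2l; [exact: ltW|lra].
by apply/ler_normlP; split; lra.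
Unshelve. all: by end_near. Qed.

(** The point [z] and the index vary together, as bounding difference quotients on a whole interval
    around [x] demands. *)
Lemma limit_reaction x eta : 0 < eta -> exists2 r, 0 < r &
  \forall n \near U, forall z, `|z - x| <= r ->
    `|reaction h d a f (w n) z - reaction h d a f phi x| <= eta.
Proof.
move=> eta0; have [L L0 HL] := limit_lipschitz; have p := limit_profile.
have eta20 : 0 < eta / 2 by rewrite divr_gt0.
have [rho [rho0 Hrho]] := f_unif eta20.
(* Values will be [2 * s] close; this becomes [4 * s] for the convolution and [8 * s] for [Delta1],
   whose coefficients have total size 4. *)
pose s := Num.min (rho / 4) (eta / (16 * d)).
have s0 : 0 < s by rewrite lt_min !divr_gt0// mulr_gt0.
have s1 : 4 * s <= rho.
  have : s <= rho / 4 by rewrite /s ge_min lexx.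
  lra.
have s2 : d * (8 * s) <= eta / 2.
  have : s <= eta / (16 * d) by rewrite /s ge_min lexx orbT.
  by rewrite ler_pdivlMr ?mulr_gt0//; lra.
have s20 : 0 < 2 * s by rewrite mulr_gt0.
have [A HA] := convol_le_far h_ge0 h_int h_mass (ltW K0) s20.
pose W := `|x| + 2 + `|a| + `|A|.
pose r := Num.min 1 (s / L).
have r0 : 0 < r by rewrite lt_min ltr01 divr_gt0.
exists r => //; near=> n => z zr.
have unif : forall y, `|y| <= W -> `|w n y - phi y| <= s.
  by near: n; exact: limit_locally_uniform.
have close y : `|y| <= 1 + `|a| + `|A| -> `|w n (z + y) - phi (x + y)| <= 2 * s.
  move=> yW; have r1 : r <= 1 by rewrite /r ge_min lexx.
  have rs : L * r <= s by rewrite mulrC -ler_pdivlMr// /r ge_min lexx orbT.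
  have /unif/ler_normlP[u1 u2] : `|z + y| <= W.
    rewrite (le_trans (ler_normD _ _))//.
    have : `|z| <= `|x| + 1.
      rewrite -[z](subrK x) addrC (le_trans (ler_normD _ _))// lerD2l.
      exact: le_trans zr r1.
    rewrite /W; lra.
  have /ler_normlP[z1 z2] := zr.
  have h1 : phi (z + y) <= phi (x + y + r) by apply: p.1; lra.
  have h2 : phi (x + y - r) <= phi (z + y) by apply: p.1; lra.
  have h3 : phi (x + y + r) - phi (x + y) <= L * (x + y + r - (x + y)) by apply: HL; lra.
  have h4 : phi (x + y) - phi (x + y - r) <= L * (x + y - (x + y - r)) by apply: HL; lra.
  have e3 : x + y + r - (x + y) = r by ring.
  have e4 : x + y - (x + y - r) = r by ring.
  rewrite e3 in h3; rewrite e4 in h4.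
  by apply/ler_normlP; split; lra.
have close0 := close 0; rewrite !addr0 normr0 in close0.
have na := normr_ge0 a; have nA := normr_ge0 A.
have /ler_normlP[c1 c2] : `|w n z - phi x| <= 2 * s by apply: close0; lra.
have /ler_normlP[c3 c4] : `|w n (z + 1) - phi (x + 1)| <= 2 * s.
  by apply: close; rewrite normr1; lra.
have /ler_normlP[c5 c6] : `|w n (z - 1) - phi (x - 1)| <= 2 * s.
  by apply: close; rewrite normrN normr1; lra.
have closeA y : `|y| <= A -> `|w n (z - a - y) - phi (x - a - y)| <= 2 * s.
  move=> yA; rewrite -![_ - a - y]addrA; apply: close.
  rewrite (le_trans (ler_normB _ _))// normrN; have := ler_norm A; lra.
have cv1 : convol h (w n) (z - a) <= convol h phi (x - a) + 2 * (2 * s).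
  apply: (HA _ _ _ _ (w_profile n) p) => y /closeA/ler_normlP[_ hy]; lra.
have cv2 : convol h phi (x - a) <= convol h (w n) (z - a) + 2 * (2 * s).
  apply: (HA _ _ _ _ p (w_profile n)) => y /closeA/ler_normlP[hy _]; lra.
have /ler_normlP[f1 f2] : `|f (w n z) (convol h (w n) (z - a))
    - f (phi x) (convol h phi (x - a))| <= eta / 2.
  apply: Hrho.
  - split; first exact: (w_profile n).2.
    exact: (convol_itv h_ge0 h_int h_mass (z - a) (w_profile n)).
  - by split; [exact: p.2|exact: (convol_itv h_ge0 h_int h_mass (x - a) p)].
  - by apply/ler_normlP; split; lra.
  - by apply/ler_normlP; split; lra.
rewrite /reaction.
have D1 : Delta1 (w n) z - Delta1 phi x <= 8 * s by rewrite /Delta1; lra.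
have D2 : - (8 * s) <= Delta1 (w n) z - Delta1 phi x by rewrite /Delta1; lra.
have := ler_wpM2l (ltW d0) D1; have := ler_wpM2l (ltW d0) D2.
by move=> h1 h2; apply/ler_normlP; split; lra.
Unshelve. all: by end_near. Qed.

Lemma limit_is_derive x : is_derive x (1 : R) phi (reaction h d a f phi x / c).
Proof.
apply: is_derive_of_le => eta eta0.
(* One half is for the error in the reaction, the other for the residual [e n]. *)
have ce0 : 0 < c * eta / 2 by rewrite divr_gt0// mulr_gt0.
have [r r0 Hr] := limit_reaction x ce0.
pose F := reaction h d a f phi x.
have inc y z : x - r <= y -> y <= z -> z <= x + r ->
    (F - c * eta) * (z - y) <= c * (phi z - phi y) <= (F + c * eta) * (z - y).
  move=> xy yz zx; apply: limit_increments => //; near=> n => t /andP[yt tz].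
  have e1 : e n <= c * eta / 2 by apply/ltW; near: n; exact: cvgr_lt e_cvg _ ce0.
  have : forall z, `|z - x| <= r -> `|reaction h d a f (w n) z - F| <= c * eta / 2.
    by near: n; exact: Hr.
  move=> /(_ t) H; have /H/ler_normlP[h1 h2] : `|t - x| <= r.
    by apply/ler_normlP; split; lra.
  by have /andP[h3 h4] := w_eq n t; apply/andP; split; lra.
exists r => // y /ler_normlP[y1 y2]; rewrite -(ler_pM2l c0).
rewrite -[X in X * `|_| <= _](gtr0_norm c0) -normrM mulrBr.
have -> : c * (F / c * (y - x)) = F * (y - x) by field; rewrite gt_eqF.
have [xy|/ltW yx] := lerP x y.
  have /andP[h1 h2] : (F - c * eta) * (y - x) <= c * (phi y - phi x) <= (F + c * eta) * (y - x).
    by apply: inc; lra.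
  by apply/ler_normlP; split; lra.
have /andP[h1 h2] : (F - c * eta) * (x - y) <= c * (phi x - phi y) <= (F + c * eta) * (x - y).
  by apply: inc; lra.
by apply/ler_normlP; split; lra.
Unshelve. all: by end_near. Qed.

End wave_limit.

(** * End states are zeros of [f (u, u)] *)

Section wave_end_states.
Context {R : realType}.
Variables (K c : R) (f : R -> R -> R) (phi phi' : R -> R).
Hypothesis c0 : 0 < c.
Hypothesis f_gt0 : forall u, 0 < u < K -> 0 < f u u.
Hypothesis phi_derive : forall x : R, is_derive x (1 : R) phi (phi' x / c).

(** If [eta = f l l] were positive, [phi] would grow by more than [eta / (2 * c)] over a unit
    interval on which it stays within [eta / (8 * c)] of [l]. The first condition on [F] holds at
    both infinities. *)
Lemma end_state (F : set_system R) {FF : ProperFilter F} (l : R) :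
  (forall P, F P -> exists x, forall z, x <= z <= x + 1 -> P z) ->
  0 <= l <= K -> phi x @[x --> F] --> l -> phi' x @[x --> F] --> f l l ->
  l = 0 \/ l = K.
Proof.
move=> Fitv /andP[l0 lK] cphi cphi'.
have [->|lneq0] := eqVneq l 0; first by left.
have [->|lneqK] := eqVneq l K; first by right.
have eta0 : 0 < f l l by apply: f_gt0; rewrite lt_def lneq0 l0 lt_neqAle lneqK.
set eta := f l l in eta0 cphi'.
have eps0 : 0 < eta / (8 * c) by rewrite divr_gt0// mulr_gt0.
have half : eta / 2 < eta by lra.
have /cvgrPdist_le /(_ _ eps0) near_phi := cphi.
have near_phi' : \forall x \near F, eta / 2 < phi' x by exact: cvgr_gt cphi' _ half.
have [x Hx] := Fitv _ (filterI near_phi near_phi').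
have x1 : x < x + 1 by rewrite ltrDl.
have [z] := @MVT R phi (fun z => phi' z / c) x (x + 1) x1 (fun z _ => phi_derive z)
  (continuous_subspaceT (fun z => differentiable_continuous
     (proj1 (derivable1_diffP _ _) (@ex_derive _ _ _ _ _ _ _ (phi_derive z))))).
rewrite in_itv/= => /andP[/ltW xz /ltW zx]; rewrite addrAC subrr add0r mulr1 => E.
have [_ ltz] := Hx z (introT andP (conj xz zx)).
have [/ler_normlP[a1 a2] _] := Hx x (introT andP (conj (lexx _) (ltW x1))).
have [/ler_normlP[b1 b2] _] := Hx (x + 1) (introT andP (conj (ltW x1) (lexx _))).
have : eta / 2 / c < phi' z / c by rewrite ltr_pM2r// invr_gt0.
rewrite -E; have -> : eta / 2 / c = 4 * (eta / (8 * c)) by field; rewrite gt_eqF.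
lra.
Qed.

End wave_end_states.

(** * Pointwise limits along an ultrafilter *)

Lemma ultra_fmap (T V : Type) (f : T -> V) (F : set_system T) :
  UltraFilter F -> UltraFilter (f @ F).
Proof.
move=> FU; split=> [|G GF subG]; first exact: fmap_proper_filter.
apply/seteqP; split=> [A GA|]; last exact: subG.
have [//|FnA] := in_ultra_setVsetC (f @^-1` A) FU.
have GnA : G (~` A) by exact: subG.
by have /filter_ex [v []] : G (A `&` ~` A) by exact: filterI.
Qed.

(** By compactness of [[0, K]], a single ultrafilter converges at all points simultaneously,
    replacing a diagonal extraction. *)
Lemma ultra_pointwise_limit {R : realType} (K : R) (w : nat -> R -> R) :
  (forall n x, 0 <= w n x <= K) -> exists (U : set_system nat) (phi : R -> R),
  [/\ ProperFilter U, \oo `<=` U & forall x, w n x @[n --> U] --> phi x].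
Proof.
move=> wK; have [U [UU subU]] := @ultraFilterLemma nat \oo _.
have lim x : exists l : R, w n x @[n --> U] --> l.
  have := @segment_compact R 0 K; rewrite compact_ultra.
  move=> /(_ (w n x @[n --> U]) (ultra_fmap _ UU)) [|l [_ cl]]; last by exists l.
  by apply: nearW => n /=; rewrite in_itv/= wK.
have [phi Hphi] := choice lim.
by exists U, phi; split=> //; exact: ultra_proper.
Qed.

(** * The critical wave as a limit of pinned discrete waves *)

Theorem theorem3p2 (R : realType) (d tau K : R) (f : R -> R -> R) (h : R -> R)
  (d1f d2f : R -> R -> R) (lam0 : \bar R) (cs : R) :
  0 < d -> 0 <= tau -> 0 < K ->
  (* partial derivatives of f exist on [0,K]^2 *)
  (forall u v, sq K u v -> has_pd1 K f u v (d1f u v)) ->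
  (forall u v, sq K u v -> has_pd2 K f u v (d2f u v)) ->
  (* (F1) *)
  {within [set p : R * R | sq K p.1 p.2], continuous (fun p => f p.1 p.2)} ->
  f 0 0 = 0 -> f K K = 0 ->
  (forall u, 0 < u < K -> 0 < f u u) ->
  (forall u v, sq K u v -> 0 <= d2f u v) ->
  (* (F2) *)
  (exists M sigma : R, 0 < M /\ 0 < sigma <= 1 /\
     forall u v, sq K u v ->
       0 <= d1f 0 0 * u + d2f 0 0 * v - f u v <= M * (u + v) `^ (1 + sigma)) ->
  d1f K K + d2f K K < 0 ->
  (* (H1) *)
  (forall x, 0 <= h x) -> (forall x, h (- x) = h x) ->
  (@lebesgue_measure R).-integrable setT (EFin \o h) ->
  (\int[@lebesgue_measure R]_x (h x)%:E = 1)%E ->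
  (* (H2) *)
  (0 < lam0)%E ->
  (forall lam : R, (lam%:E < lam0)%E ->
     (\int[@lebesgue_measure R]_(x in `[0%R, +oo[) (h x * expR (lam * x))%:E < +oo)%E) ->
  (* c^* is the unique c > 0 admitting lambda_star in (0, lambda^+) with
     Delta(c,lambda_star) = 0 = d_lambda Delta(c,lambda_star) *)
  0 < cs -> crit d tau (d1f 0 0) (d2f 0 0) h lam0 cs -> (forall c, 0 < c -> crit d tau (d1f 0 0) (d2f 0 0) h lam0 c -> c = cs) ->
  (* c^* is the unique such c > 0 *)
  (* conclusion *)
  exists phi : R -> R,
    (forall xi, derivable phi xi 1) /\
    (forall xi, - cs * 'D_1 phi xi + d * Delta1 phi xi
                + f (phi xi) (convol h phi (xi - cs * tau)) = 0) /\
    phi x @[x --> -oo] --> 0 /\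
    phi x @[x --> +oo] --> K /\
    (forall xi, 0 <= phi xi <= K) /\
    (forall xi, 0 < phi xi < K) /\
    (forall xi, 0 < 'D_1 phi xi).
Proof.
move=> d0 _ K0 pd1 pd2 f_cont f00 fKK f_gt0 d2f_ge0 [M [sigma [M0 [/andP[sigma0 _] f_lin]]]] _.
move=> h_ge0 h_even h_int h_mass _ h_exp c0 [lams [lams0 [lams_lt [Delta0 _]]]] _.
have sq00 : sq K 0 0 by split; rewrite lexx ltW.
have sqKK : sq K K K by split; rewrite lexx ltW.
have bounded := f_bounded f_cont; have unif := f_unif f_cont.
have homo := f_homo pd2 f_cont d2f_ge0.
have lip a v := @f_pd1_lip R K f d1f pd1 f_cont a v.
(* Evaluating the linear upper bound at [(K / 2, K / 2)], where [f] is positive. *)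
have d12_gt0 : 0 < d1f 0 0 + d2f 0 0.
  have K2 : 0 < K / 2 < K by apply/andP; split; lra.
  have sqK2 : sq K (K / 2) (K / 2) by split; apply/andP; split; lra.
  have /andP[h1 _] := f_lin _ _ sqK2; have h2 := f_gt0 _ K2.
  have /andP[K20 _] := K2; rewrite -(pmulr_lgt0 _ K20); lra.
have lams_eq : cs * lams = characteristic h d (cs * tau) (d1f 0 0) (d2f 0 0) lams.
  by move: Delta0; rewrite /Delta /characteristic -[- lams * cs * tau]mulrA; lra.
have waves := discrete_wave h_ge0 h_even h_int h_mass h_exp K0 c0 d0 (d2f_ge0 _ _ sq00)
  d12_gt0 bounded unif (lip _ _ sqKK) homo f00 fKK f_gt0 M0 sigma0 f_lin lams0 lams_lt lams_eq.
set a := cs * tau in waves *.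
have harm_gt0 n : 0 < @harmonic R n by rewrite /harmonic/= invr_gt0.
have /choice[dw Hdw] n : exists dw : R * (R -> R), [/\ 0 < dw.1 <= harmonic n,
    profile K dw.2, (forall x, x < 0 -> dw.2 x <= K / 2) /\ (forall x, 0 < x -> K / 2 <= dw.2 x) &
    forall x, reaction h d a f dw.2 x <= cs / dw.1 * (dw.2 (x + dw.1) - dw.2 x)
                <= reaction h d a f dw.2 x + harmonic n].
  have [r r0 Hr] := waves _ (harm_gt0 n).
  have m0 : 0 < Num.min (r / 2) (harmonic n) by rewrite lt_min divr_gt0//=.
  have mr : Num.min (r / 2) (harmonic n) < r by rewrite gt_min; apply/orP; left; lra.
  have [|w [pw wl wr we]] := Hr (Num.min (r / 2) (harmonic n)); first by rewrite m0.
  by exists (Num.min (r / 2) (harmonic n), w); split=> //=; rewrite m0 ge_min lexx orbT.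
pose w n := (dw n).2; pose dl n := (dw n).1.
have pw n : profile K (w n) by case: (Hdw n).
have dl_gt0 n : 0 < dl n by case: (Hdw n) => /andP[].
have [U [phi [UF subU w_cvg]]] := ultra_pointwise_limit (fun n => (pw n).2).
have e_cvg : harmonic n @[n --> U] --> (0 : R).
  by apply: cvg_trans (@cvg_harmonic R) => A HA; exact: subU.
have dl_cvg : dl n @[n --> U] --> (0 : R).
  apply: (squeeze_cvgr _ (cvg_cst 0) e_cvg); apply: nearW => n.
  by case: (Hdw n) => /andP[? ?] _ _ _; rewrite ltW.
have we n x : reaction h d a f (w n) x <= cs / dl n * (w n (x + dl n) - w n x)
    <= reaction h d a f (w n) x + harmonic n by case: (Hdw n).
have p : profile K phi := @limit_profile R K w U UF pw phi w_cvg.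
have D : forall x : R, is_derive x (1 : R) phi (reaction h d a f phi x / cs) :=
  limit_is_derive h_ge0 h_int h_mass K0 c0 d0 bounded unif (UF := UF) pw dl_gt0 dl_cvg
    e_cvg we w_cvg.
have [left right] : (forall x, x < 0 -> phi x <= K / 2) /\ (forall x, 0 < x -> K / 2 <= phi x).
  split=> x x0.
    apply: (closed_cvg _ (@closed_le R (K / 2)) _ _ (@w_cvg x)); apply: nearW => n /=.
    by case: (Hdw n) => _ _ [+ _] _; apply.
  apply: (closed_cvg _ (@closed_ge R (K / 2)) _ _ (@w_cvg x)); apply: nearW => n /=.
  by case: (Hdw n) => _ _ [_ +] _; apply.
have phiy : phi x @[x --> +oo] --> K.
  have [l cl] : exists l : R, phi x @[x --> +oo] --> l.
    exists (sup (range phi)); apply: nondecreasing_cvgr; first exact: p.1.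
    by exists K => _ [x _ <-]; case/andP: (p.2 x).
  have cls s : phi (x + s) @[x --> +oo] --> l by rewrite (cvg_shiftr s).
  have lI : 0 <= l <= K by exact: profile_limit_itv p cls.
  have [|l0|<-//] := end_state c0 f_gt0 D _ lI cl
    (reaction_cvg d a h_ge0 h_int h_mass unif p cls).
    by move=> P [X [_ HX]]; exists (X + 1) => z /andP[Xz _]; apply: HX; lra.
  have : K / 2 <= l.
    apply: (closed_cvg _ (@closed_ge R (K / 2)) _ _ cl).
    by near=> x; apply: right; near: x; exact: nbhs_pinfty_gt.
  by rewrite l0; lra.
have phiNy : phi x @[x --> -oo] --> 0.
  have [l cl] : exists l : R, phi x @[x --> -oo] --> l.
    (* Monotone convergence at [+oo] is applied to the reflected profile [- phi (- x)]. *)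
    exists (- sup (range (fun x => - phi (- x)))); apply/cvgNy_compNP.
    rewrite (_ : phi \o -%R = - (fun x => - phi (- x))); last first.
      by apply/funext => x; rewrite /= fctE opprK.
    apply: cvgN; apply: nondecreasing_cvgr.
      by move=> x y xy; rewrite lerN2; apply: p.1; rewrite lerN2.
    by exists 0 => _ [x _ <-]; rewrite oppr_le0; case/andP: (p.2 (- x)).
  have cls s : phi (x + s) @[x --> -oo] --> l.
    exact: (cvg_comp _ _ (@cvg_addrr_Ny R s) cl).
  have lI : 0 <= l <= K by exact: profile_limit_itv p cls.
  have [|<-//|lK] := end_state c0 f_gt0 D _ lI cl
    (reaction_cvg d a h_ge0 h_int h_mass unif p cls).
    by move=> P [X [_ HX]]; exists (X - 2) => z /andP[_ zX]; apply: HX; lra.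
  have : l <= K / 2.
    apply: (closed_cvg _ (@closed_le R (K / 2)) _ _ cl).
    by near=> x; apply: left; near: x; exact: nbhs_ninfty_lt.
  by rewrite lK; lra.
pose psi x := convol h phi (x - a).
have ppsi : profile K psi.
  split=> [x y xy|x]; last exact: (convol_itv h_ge0 h_int h_mass _ p).
  by apply: (convol_homo h_ge0 h_int p); rewrite lerD2r.
have pos x : 0 < reaction h d a f phi x / cs.
  exact: (phi_derive_gt0 c0 d0 K0 lip homo f00 p ppsi D phiNy phiy).
have DE x : 'D_1 phi x = reaction h d a f phi x / cs by exact: derive_val.
have incr x y : x < y -> phi x < phi y.
  move=> xy; apply: (@gtr0_derive1_lt_cc R phi x y) => //; rewrite ?in_itv/= ?lexx ?(ltW xy)//.
  - by move=> z _; rewrite derive1E DE.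
  - apply: continuous_subspaceT => z; apply: differentiable_continuous.
    by apply/derivable1_diffP.
exists phi; split; first by move=> x; case: (D x).
split.
  by move=> x; rewrite DE /reaction -/a; field; rewrite gt_eqF.
split=> //; split=> //; split; first exact: p.2.
split=> x; last by rewrite DE.
(* Strict bounds come from comparing [phi x] with [phi (x - 1) >= 0] and [phi (x + 1) <= K]. *)
apply/andP; split.
  have /andP[h1 _] := p.2 (x - 1); apply: le_lt_trans h1 _; apply: incr; lra.
have /andP[_ h1] := p.2 (x + 1); apply: lt_le_trans h1; apply: incr; lra.
Unshelve. all: by end_near. Qed.
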